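(* Let $X\subset Y$ be separable real Banach spaces ($X$ a nonzero closed subspace of $Y$ with the norm of $Y$), and suppose that $X$ has the Daugavet property. Then: (a) Let $K$ be the weak$^*$ closure of $\operatorname{ex} B_{X^*}$ in $X^*$, endowed with the weak$^*$ topology, and let $Q\colon \ell_\infty(K)\to m_0(K)$ be the quotient map. Regard $X$ as a subspace of $C(K)\subset\ell_\infty(K)$ via $x\mapsto (x^*\mapsto x^*(x))$. Then there is an isomorphic embedding $S\colon Y\to m_0(K)$ with $S|_X=Q|_X$. (b) The space $Y$ can be equivalently renormed so that the new norm coincides with the original one on $X$ and the pair $(X,Y)$ has the Daugavet property for the new norm.
   Context: A Banach space $X$ has the Daugavet property if $\|\mathrm{Id}+T\|=1+\|T\|$ for every bounded linear operator $T\colon X\to X$ of rank $1$. If $X$ is a closed subspace of a Banach space $Y$ with inclusion $J\colon X\to Y$, the pair $(X,Y)$ has the Daugavet property if $\|J+T\|=1+\|T\|$ for every bounded linear operator $T\colon X\to Y$ of rank $1$. $B_{X^*}$ is the closed unit ball of $X^*$ and $\operatorname{ex}C$ is the set of extreme points of $C$. For a compact (Hausdorff) space $K$, $\ell_\infty(K)$ is the space of all bounded real-valued functions on $K$ with the sup-norm, $m(K)$ is the closed subspace of those $f\in\ell_\infty(K)$ for which $\{t\in K: f(t)\neq 0\}$ is of first category in $K$, and $m_0(K):=\ell_\infty(K)/m(K)$ with the quotient norm. (The restriction of the quotient map $Q$ to $C(K)$ is an isometry.) An isomorphic embedding is a linear operator that is an isomorphism onto its (closed) range. *)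

(* Defs.v *)
From HB Require Import structures.
From mathcomp Require Import all_boot all_order all_algebra generic_quotient.
From mathcomp Require Import ring_quotient.
From mathcomp Require Import all_classical all_reals all_analysis.
From mathcomp Require Import lra.

Set Implicit Arguments.
Unset Strict Implicit.
Unset Printing Implicit Defensive.

Import Order.TTheory GRing.Theory Num.Theory.
Import numFieldNormedType.Exports.

Local Open Scope classical_set_scope.
Local Open Scope ring_scope.

Definition separable (T : topologicalType) : Prop :=
  exists2 D : set T, countable D & dense D.

Definition nowhere_dense (T : topologicalType) (A : set T) : Prop :=
  interior (closure A) = set0.

Definition first_category (T : topologicalType) (A : set T) : Prop :=
  exists2 F : nat -> set T,
    (forall n, nowhere_dense (F n)) & A = \bigcup_n F n.

Definition extreme_points (R : realType) (V : lmodType R) (C : set V) : set V :=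
  [set x | C x /\ forall (y z : V) (t : R), C y -> C z -> 0 < t < 1 ->
    x = t *: y + (1 - t) *: z -> y = x /\ z = x].

(* The norm of the codomain is an argument, so that the codomain can be
   renormed; the value is meaningful only when [T] is bounded for [N]. *)
Definition opnorm (R : realType) (X : normedModType R) (V : lmodType R)
    (N : V -> R) (T : X -> V) : R :=
  sup [set N (T x) | x in [set x : X | `|x| <= 1]].

Definition bounded_op (R : realType) (X : normedModType R) (V : lmodType R)
    (N : V -> R) (T : X -> V) : Prop :=
  exists M : R, forall x, N (T x) <= M * `|x|.

Definition rank_one (R : realType) (X V : lmodType R) (T : X -> V) : Prop :=
  exists2 v : V, v != 0 & range T = [set a *: v | a in [set: R]].

(* [X] keeps its own norm and [N] is the norm of the larger space, so this is
   the property of the pair only when [N (J x) = `|x|]. *)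
Definition daugavet_pair (R : realType) (X : normedModType R) (V : lmodType R)
    (N : V -> R) (J : X -> V) : Prop :=
  forall T : {linear X -> V}, bounded_op N T -> rank_one T ->
    opnorm N (fun x => J x + T x) = 1 + opnorm N T.

Definition daugavet_property (R : realType) (X : normedModType R) : Prop :=
  daugavet_pair (fun x : X => `|x|) (fun x : X => x).

Record is_norm (R : realType) (V : lmodType R) (N : V -> R) : Prop := IsNorm {
  is_norm_triangle : forall x y, N (x + y) <= N x + N y;
  is_norm_homo : forall (a : R) x, N (a *: x) = `|a| * N x;
  is_norm_definite : forall x, N x = 0 -> x = 0 }.

Definition equivalent_norm (R : realType) (Y : normedModType R) (N : Y -> R) :
    Prop :=
  is_norm N /\ exists c C : R,
    [/\ 0 < c, 0 < C & forall y, c * `|y| <= N y <= C * `|y|].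

(* The inverse on the range is the restriction of [g]; since [S] is linear,
   so is that restriction. *)
Definition isomorphic_embedding (R : realType) (Y V : normedModType R)
    (S : {linear Y -> V}) : Prop :=
  [/\ continuous S, closed (range S) &
      exists2 g : V -> Y, cancel S g & {within range S, continuous g}].

Section Subspace.
Variables (R : realType) (Y : normedModType R) (X : submodClosed Y).

Record subsp := Subsp { subsp_val :> Y; subspP : subsp_val \in X }.

HB.instance Definition _ := [isSub of subsp for subsp_val].
HB.instance Definition _ := [Choice of subsp by <:].
HB.instance Definition _ := [SubChoice_isSubLmodule of subsp by <:].

Let nm (x : subsp) : R := `|subsp_val x|.

Let nmD x y : nm (x + y) <= nm x + nm y.
Proof. exact: ler_normD. Qed.

Let nmZ (a : R) x : nm (a *: x) = `|a| * nm x.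
Proof. exact: normrZ. Qed.

Let nm0 x : nm x = 0 -> x = 0.
Proof. by move=> /normr0_eq0 x0; exact/val_inj. Qed.

HB.instance Definition _ := Lmodule_isNormed.Build R subsp nmD nmZ nm0.

End Subspace.

Section DualSpace.
Variables (R : realType) (X : normedModType R).

Definition dual_pred : {pred X -> R^o} :=
  mem [set f : X -> R^o | linear f /\ continuous f].

Lemma dual_pred_submod : submod_closed dual_pred.
Proof.
split.
  rewrite inE; split; first by move=> a x y; rewrite /GRing.zero/= scaler0 addr0.
  by move=> x; exact: cvg_cst.
move=> a f g; rewrite !inE => -[lf cf] [lg cg]; split.
  move=> b x y; rewrite -[LHS]/(a *: f _ + g _) -[RHS]/(b *: (a *: f _ + g _) +
    (a *: f _ + g _)) lf lg !scalerDr !scalerA (mulrC a) -!addrA; congr (_ + _).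
  by rewrite addrCA.
by move=> x; apply: cvgD; [apply: cvgZr; exact: cf|exact: cg].
Qed.

HB.instance Definition _ :=
  GRing.isSubmodClosed.Build R (X -> R^o) dual_pred dual_pred_submod.

Record dual_space :=
  Dual { dual_fun :> X -> R^o; dualP : dual_fun \in dual_pred }.

HB.instance Definition _ := [isSub of dual_space for dual_fun].
HB.instance Definition _ := [Choice of dual_space by <:].
HB.instance Definition _ := [SubChoice_isSubLmodule of dual_space by <:].

(* The weak* topology: the coarsest one for which every evaluation
   [f |-> f x] is continuous. *)
HB.instance Definition _ := Topological.copy dual_space
  (initial_topology (dual_fun : dual_space -> {ptws X -> R^o})).

Let dual_linear (f : dual_space) : linear f.
Proof. by have /set_mem[] := dualP f. Qed.

HB.instance Definition _ (f : dual_space) :=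
  GRing.isLinear.Build R X R^o *:%R f (dual_linear f).

Lemma dual_continuous (f : dual_space) : continuous f.
Proof. by have /set_mem[] := dualP f. Qed.

Lemma dual_eval_continuous (x : X) : continuous (fun f : dual_space => f x).
Proof.
move=> f; apply: (@continuous_comp dual_space {ptws X -> R^o} R^o
  (dual_fun : dual_space -> {ptws X -> R^o}) (fun h => h x)).
  exact: initial_continuous.
exact: (@proj_continuous X (fun=> R^o) x).
Qed.

Definition dual_ball : set dual_space :=
  [set f : dual_space | opnorm (fun r : R^o => `|r|) f <= 1].

Lemma dual_ball_le (f : dual_space) : dual_ball f -> forall x, `|f x| <= `|x|.
Proof.
move=> f1 x.
have [M Mf] : exists M : R, forall x, `|f x| <= M * `|x|.
  have /linear_boundedP/pinfty_ex_gt0[M _ Mf] :=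
    continuous_linear_bounded 0 (dual_continuous (f := f) (x := 0)).
  by exists M.
have [->|x0] := eqVneq x 0; first by rewrite linear0 !normr0.
have xn0 : 0 < `|x| by rewrite normr_gt0.
have : `|f (`|x|^-1 *: x)| <= 1.
  apply: le_trans f1; apply: ub_le_sup.
    exists `|M| => _ [y /= y1 <-]; apply: le_trans (Mf y) _.
    apply: le_trans (_ : `|M| * `|y| <= _); last by rewrite ler_piMr.
    by rewrite ler_wpM2r// ler_norm.
  exists (`|x|^-1 *: x) => //=.
  by rewrite normrZ gtr0_norm ?invr_gt0// mulVf// gt_eqF.
rewrite linearZ/= normrZ gtr0_norm ?invr_gt0// mulrC.
by rewrite ler_pdivrMr// mul1r.
Qed.

Definition ex_closure : set dual_space := closure (extreme_points dual_ball).

Lemma ex_closure_le (f : dual_space) : ex_closure f -> forall x, `|f x| <= `|x|.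
Proof.
move=> Kf x.
have cl : closed [set g : dual_space | `|g x| <= `|x|].
  apply: (@closed_comp dual_space R^o (fun g => g x) [set r | `|r| <= `|x|]).
    by move=> g _; exact: dual_eval_continuous.
  apply: (@closed_comp R^o R (fun r => `|r|) [set r | r <= `|x|]).
    by move=> g _; exact: (@norm_continuous R R^o g).
  exact: closed_le.
move/closure_id: cl => cl; rewrite -/([set g : dual_space | `|g x| <= `|x|] f) cl.
by move: Kf; apply: closure_subset => g [/dual_ball_le + _]; exact.
Qed.

End DualSpace.

Arguments dual_ball {R} X _.
Arguments ex_closure {R} X _.

Section BoundedFunctions.
Variables (R : realType) (K : Type).

Definition linf_pred : {pred K -> R^o} := mem (bounded_fun : set (K -> R^o)).

Lemma linf_predP (f : K -> R^o) :
  reflect (exists M : R, forall t, `|f t| <= M) (f \in linf_pred).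
Proof.
apply: (iffP idP) => [/set_mem/= /pinfty_ex_gt0[M _ fM]|[M fM]].
  by exists M => t; exact: fM.
apply: mem_set; exists M; split=> [|L /ltW ML t _]; first exact: num_real.
exact: le_trans (fM t) ML.
Qed.

Lemma linf_pred_submod : submod_closed linf_pred.
Proof.
split; first by apply/linf_predP; exists 0 => t; rewrite normr0.
move=> a f g /linf_predP[M fM] /linf_predP[L gL]; apply/linf_predP.
exists (`|a| * M + L) => t; apply: le_trans (ler_normD _ _) _.
by rewrite lerD// normrZ ler_wpM2l.
Qed.

HB.instance Definition _ :=
  GRing.isSubmodClosed.Build R (K -> R^o) linf_pred linf_pred_submod.

Record linf := Linf { linf_fun :> K -> R^o; linfP : linf_fun \in linf_pred }.

HB.instance Definition _ := [isSub of linf for linf_fun].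
HB.instance Definition _ := [Choice of linf by <:].
HB.instance Definition _ := [SubChoice_isSubLmodule of linf by <:].

Definition sup_norm (f : linf) : R := sup [set `|f t| | t in [set: K]].

Lemma sup_norm_ge (f : linf) t : `|f t| <= sup_norm f.
Proof.
have /linf_predP[M fM] := linfP f.
by apply: ub_le_sup; [exists M => _ [s _ <-]|exists t].
Qed.

Lemma sup_norm_le (f : linf) (M : R) :
  0 <= M -> (forall t, `|f t| <= M) -> sup_norm f <= M.
Proof.
move=> M0 fM; rewrite /sup_norm.
have [->|/set0P ne] := eqVneq [set `|f t| | t in [set: K]] set0.
  by rewrite sup0.
by apply: ge_sup => // _ [t _ <-].
Qed.

Lemma sup_norm_ge0 (f : linf) : 0 <= sup_norm f.
Proof.
rewrite /sup_norm.
have [->|/set0P[_ [t _ _]]] := eqVneq [set `|f t| | t in [set: K]] set0.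
  by rewrite sup0.
exact: le_trans (normr_ge0 _) (sup_norm_ge f t).
Qed.

Let sup_normD (f g : linf) : sup_norm (f + g) <= sup_norm f + sup_norm g.
Proof.
apply: sup_norm_le => [|t]; first by rewrite addr_ge0// sup_norm_ge0.
by apply: le_trans (ler_normD _ _) _; rewrite lerD// sup_norm_ge.
Qed.

Let sup_normZ_le (a : R) (f : linf) : sup_norm (a *: f) <= `|a| * sup_norm f.
Proof.
apply: sup_norm_le => [|t]; first by rewrite mulr_ge0// sup_norm_ge0.
by rewrite normrZ ler_wpM2l// sup_norm_ge.
Qed.

Let sup_normZ (a : R) (f : linf) : sup_norm (a *: f) = `|a| * sup_norm f.
Proof.
apply/eqP; rewrite eq_le sup_normZ_le/=.
have [->|a0] := eqVneq a 0; first by rewrite normr0 mul0r sup_norm_ge0.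
have := sup_normZ_le a^-1 (a *: f); rewrite scalerA mulVf// scale1r.
by rewrite normfV mulrC ler_pdivlMr ?normr_gt0// mulrC.
Qed.

Let sup_norm0 (f : linf) : sup_norm f = 0 -> f = 0.
Proof.
move=> f0; apply/val_inj/funext => t /=; apply/normr0_eq0/eqP.
by rewrite eq_le normr_ge0 -f0 sup_norm_ge.
Qed.

HB.instance Definition _ :=
  Lmodule_isNormed.Build R linf sup_normD sup_normZ sup_norm0.

End BoundedFunctions.

Section FirstCategory.
Variable T : topologicalType.

Lemma nowhere_dense0 : nowhere_dense (@set0 T).
Proof.
by rewrite /nowhere_dense closure0; apply/interior_id; exact: open0.
Qed.

Lemma nowhere_dense_subset (A B : set T) :
  A `<=` B -> nowhere_dense B -> nowhere_dense A.
Proof.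
rewrite /nowhere_dense => AB B0; rewrite -subset0 -B0.
by apply: interiorS; exact: closure_subset.
Qed.

Lemma first_category_subset (A B : set T) :
  A `<=` B -> first_category B -> first_category A.
Proof.
move=> AB [F F0 BF]; exists (fun n => A `&` F n).
  by move=> n; apply: nowhere_dense_subset (F0 n); exact: subIsetr.
by rewrite -setI_bigcupr -BF; apply/esym/setIidPl.
Qed.

Lemma first_category_bigcup (A : nat -> set T) :
  (forall n, first_category (A n)) -> first_category (\bigcup_n A n).
Proof.
move=> /(_ _)/cid2-/all_sig2[F F0 AF].
exists (fun k => if unpickle k is Some (n, m) then F n m else set0).
  move=> k; case: unpickle => [[n m]|]; first exact: F0.
  exact: nowhere_dense0.
apply/seteqP; split=> [t [n _]|t [k _]].
  by rewrite AF => -[m _ Ft]; exists (pickle (n, m)) => //; rewrite pickleK.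
case: unpickle => [[n m] Ft|//]; exists n => //.
by rewrite AF; exists m.
Qed.

Lemma first_category0 : first_category (@set0 T).
Proof.
exists (fun=> set0); last by rewrite bigcup0.
by move=> _; exact: nowhere_dense0.
Qed.

Lemma first_categoryU (A B : set T) :
  first_category A -> first_category B -> first_category (A `|` B).
Proof.
move=> A1 B1; have := @first_category_bigcup (fun n => if n is 0 then A else B).
have -> : \bigcup_n (if n is 0 then A else B) = A `|` B.
  apply/seteqP; split=> [t [[|n] _]|t [At|Bt]]; first by left.
  - by right.
  - by exists 0%N.
  - by exists 1%N.
by apply; case.
Qed.

End FirstCategory.

Section M0.
Variables (R : realType) (K : topologicalType).

Definition m_pred : {pred linf R K} :=
  mem [set f : linf R K | first_category [set t | f t != 0]].

Lemma m_pred_submod : submod_closed m_pred.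
Proof.
split.
  apply/mem_set; apply: first_category_subset (first_category0 K) => t /=.
  by rewrite eqxx.
move=> a f g /set_mem f0 /set_mem g0; apply/mem_set.
apply: first_category_subset (first_categoryU f0 g0) => t /= fgt.
have [ft|] := eqVneq (f t) 0; last by left.
right; apply: contra_neq fgt => gt.
by rewrite -[LHS]/(a *: f t + g t) ft gt scaler0 addr0.
Qed.

HB.instance Definition _ :=
  GRing.isSubmodClosed.Build R (linf R K) m_pred m_pred_submod.

Local Open Scope quotient_scope.

Definition m0 : Type := Quotient.quot m_pred.

HB.instance Definition _ := GRing.Zmodule.on m0.
HB.instance Definition _ := EqQuotient.on m0.
HB.instance Definition _ := ZmodQuotient.on m0.

Definition m0_proj (f : linf R K) : m0 := \pi f.

Lemma m0_projP (f g : linf R K) :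
  reflect (m0_proj f = m0_proj g) (f - g \in m_pred).
Proof. by rewrite Quotient.idealrBE; exact: eqP. Qed.

Lemma m0_projD : {morph m0_proj : f g / f + g}.
Proof. exact: raddfD. Qed.

Lemma m0_projK (q : m0) : m0_proj (repr q) = q.
Proof. exact: reprK. Qed.

Definition m0_scale (a : R) (q : m0) : m0 := m0_proj (a *: repr q).

Lemma m0_projZ (a : R) f : m0_proj (a *: f) = m0_scale a (m0_proj f).
Proof.
apply/m0_projP; rewrite -scalerBr; apply: rpredZ; apply/m0_projP.
by rewrite m0_projK.
Qed.

Let m0_scaleA a b q : m0_scale a (m0_scale b q) = m0_scale (a * b) q.
Proof. by rewrite -m0_projZ scalerA. Qed.

Let m0_scale1 : left_id 1 m0_scale.
Proof. by move=> q; rewrite /m0_scale scale1r m0_projK. Qed.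

Let m0_scaleDr : right_distributive m0_scale +%R.
Proof.
move=> a p q; rewrite -[p]m0_projK -[q]m0_projK -m0_projD -!m0_projZ.
by rewrite scalerDr m0_projD.
Qed.

Let m0_scaleDl q : {morph m0_scale^~ q : a b / a + b}.
Proof. by move=> a b; rewrite /m0_scale scalerDl m0_projD. Qed.

HB.instance Definition _ := GRing.Zmodule_isLmodule.Build R m0
  m0_scaleA m0_scale1 m0_scaleDr m0_scaleDl.

Let m0_proj_linear : linear m0_proj.
Proof. by move=> a f g; rewrite m0_projD m0_projZ. Qed.

HB.instance Definition _ :=
  GRing.isLinear.Build R (linf R K) m0 *:%R m0_proj m0_proj_linear.

Definition quotient_norm (q : m0) : R :=
  inf [set `|f| | f in [set f : linf R K | m0_proj f = q]].

Lemma quotient_norm_le f : quotient_norm (m0_proj f) <= `|f|.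
Proof. by apply: ge_inf; [exists 0 => _ [g _ <-]|exists f]. Qed.

Lemma quotient_norm_lt q (e : R) : 0 < e ->
  exists2 f, m0_proj f = q & `|f| < quotient_norm q + e.
Proof.
move=> e0; have [|_ [f fq <-] fe] := @inf_adherent _
    [set `|f| | f in [set f : linf R K | m0_proj f = q]] e e0.
  split; last by exists 0 => _ [g _ <-].
  by exists `|repr q|; exists (repr q) => //=; exact: m0_projK.
by exists f.
Qed.

Let quotient_norm_ge0 q : 0 <= quotient_norm q.
Proof.
apply: lb_le_inf => [|_ [f _ <-]//].
by exists `|repr q|; exists (repr q) => //=; exact: m0_projK.
Qed.

Let quotient_normD p q :
  quotient_norm (p + q) <= quotient_norm p + quotient_norm q.
Proof.
apply/ler_addgt0Pr => e e0; have e2 : 0 < e / 2 by rewrite divr_gt0.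
have [f <- fe] := quotient_norm_lt p e2.
have [g <- ge] := quotient_norm_lt q e2.
rewrite -m0_projD; apply: le_trans (quotient_norm_le _) _.
by apply: le_trans (ler_normD _ _) _; rewrite ltW//; lra.
Qed.

Let quotient_normZ_le (a : R) q :
  quotient_norm (a *: q) <= `|a| * quotient_norm q.
Proof.
apply/ler_addgt0Pr => e e0.
have d0 : 0 < e / (`|a| + 1) by rewrite divr_gt0// ltr_wpDl.
have [f <- fe] := quotient_norm_lt q d0.
rewrite -linearZ; apply: le_trans (quotient_norm_le _) _.
rewrite normrZ; apply: le_trans (ler_wpM2l (normr_ge0 a) (ltW fe)) _.
rewrite mulrDr lerD2l mulrCA -[leRHS]mulr1 ler_pM2l//.
by rewrite ler_pdivrMr ?ltr_wpDl// mul1r lerDl.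
Qed.

Let quotient_normZ (a : R) q : quotient_norm (a *: q) = `|a| * quotient_norm q.
Proof.
apply/eqP; rewrite eq_le quotient_normZ_le/=.
have [->|a0] := eqVneq a 0; first by rewrite normr0 mul0r.
have := quotient_normZ_le a^-1 (a *: q); rewrite scalerA mulVf// scale1r.
by rewrite normfV mulrC ler_pdivlMr ?normr_gt0// mulrC.
Qed.

Let quotient_norm0 q : quotient_norm q = 0 -> q = 0.
Proof.
move=> q0; rewrite -[q]m0_projK -(linear0 m0_proj); apply/m0_projP.
rewrite subr0; apply/mem_set.
have /(_ _)/cid2-/all_sig2[g gq ge] :
    forall n, exists2 g, m0_proj g = q & `|g| < n.+1%:R^-1 :> R.
  move=> n; have [|f fq] := @quotient_norm_lt q n.+1%:R^-1.
    by rewrite invr_gt0.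
  by rewrite q0 add0r; exists f.
have : first_category (\bigcup_n [set t | (repr q - g n) t != 0]).
  apply: first_category_bigcup => n; apply: set_mem.
  by apply/(m0_projP (repr q) (g n)); rewrite m0_projK gq.
apply: first_category_subset => t /= qt; apply: contrapT => nt.
have gt n : (repr q - g n) t = 0.
  by apply: contra_notP nt => /eqP gt; exists n.
have qge n : `|repr q t| < n.+1%:R^-1.
  apply: le_lt_trans (ge n); apply: le_trans (sup_norm_ge (g n) t).
  by have := gt n; rewrite -[LHS]/(repr q t - g n t) => /subr0_eq ->.
have qt0 : 0 < `|repr q t| by rewrite normr_gt0.
by have [n] := ltr_add_invr qt0; rewrite add0r => /(lt_trans (qge n)); rewrite ltxx.
Qed.

HB.instance Definition _ :=
  Lmodule_isNormed.Build R m0 quotient_normD quotient_normZ quotient_norm0.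

End M0.

Section Evaluation.
Variables (R : realType) (X : normedModType R).

Let eval_embed_bounded (x : X) :
  (fun f : ex_closure X => set_val f x : R^o) \in @linf_pred R (ex_closure X).
Proof.
apply/linf_predP; exists `|x| => f; apply: ex_closure_le.
exact: set_valP.
Qed.

Definition eval_embed (x : X) : linf R (ex_closure X) := Linf (eval_embed_bounded x).

Lemma eval_embed_continuous (x : X) : continuous (eval_embed x).
Proof.
move=> f; apply: (@continuous_comp _ (dual_space X) R^o set_val (fun g => g x)).
  exact: initial_continuous.
exact: dual_eval_continuous.
Qed.

End Evaluation.

(* Main.v *)
Require Import Defs.
From HB Require Import structures.
From mathcomp Require Import all_boot all_order all_algebra.
From mathcomp Require Import all_classical all_reals all_analysis.
From mathcomp Require Import lra ring.

Import Order.TTheory GRing.Theory Num.Theory.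
Import numFieldNormedType.Exports.

Local Open Scope classical_set_scope.
Local Open Scope ring_scope.

(** Let [K] be the weak* closure of the set of extreme points of the dual ball of
    [X]. An element [t] of [K] is a functional on [X], and a choice of a linear
    extension [g t] of every [t] to [Y], of norms bounded independently of [t],
    gives the operator that sends [y] to the class of the function
    [t |-> g t y]. On [X] this is the quotient map. The norm of a class is an
    essential supremum modulo meager sets, and [K], being compact, is a Baire
    space; so the operator is bounded below as soon as, for every [y], the
    inequality [c * `|y| <= `|g t y|] holds for all [t] in some non-empty open
    subset of [K].

    To achieve this, start from Hahn-Banach extensions [h t] of norm at most
    one. If [y] is close to [X] they suffice, because [K] norms [X]. If [y] is
    far from [X], some functional [z] of the unit ball of the dual of [Y]
    vanishes on [X] and is large at [y], and by separability of [Y] countably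
    many such [z j] suffice for all [y]. Adding a large multiple of [z j] to
    [h t] for [t] in an open set [W j] does not change the restriction of the
    functional to [X]. The sets [W j] have to be disjoint and non-empty, and
    the rest of [K] has to norm [X] still. The latter is ensured by choosing
    all of them in one open half-space slice of [K]: as [K] is symmetric,
    points outside the slice norm [X] up to sign. The former is possible
    because [K] has no isolated points, and this is where the Daugavet property
    enters ([ex_closure_perfect], [perturbed_extensions]).

    For the renorming, take the norm that this embedding induces on [Y]. The
    pair then has the Daugavet property since already the pair formed by [X]
    and the space of classes has it. Indeed, a rank-one operator is
    [g (.) *: v] with [g] of norm one; the function that represents [v] is, up
    to sign, almost equal to its norm on a non-meager set [A], and the Daugavet
    property of [X] provides a point [x] of the ball at which [g] is almost one
    and such that [x], seen as a function on [K], is almost one on a non-meager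
    part of [A] ([daugavet_slice_nonmeager]).

    That lemma rests on two facts about [K]. Every non-empty open subset of [K]
    contains a slice of [K] ([slice_in_open]), which follows from the theorem
    of Milman that a norming subset of the dual ball contains all extreme points
    in its closure ([milman]). Extreme points exist in sufficient number to norm
    [X] ([extreme_norming]), by compactness of the dual ball
    ([dual_ball_compact]). *)

(** * The Hahn-Banach theorem *)

Section HahnBanach.
Variables (R : realType) (V : lmodType R) (p : V -> R).

Definition linear_graph (G : set (V * R)) :=
  forall a u v, G u -> G v -> G (a *: u.1 + v.1, a * u.2 + v.2).

Hypotheses (pD : forall x y, p (x + y) <= p x + p y)
  (pZ : forall a x, 0 < a -> p (a *: x) = a * p x).

(** The value [c] at [w] must lie above all [r - p (x - w)] and below all
    [p (x + w) - r], for [(x, r)] in the graph. Subadditivity makes the first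
    numbers smaller than the second ones; homogeneity reduces the domination at
    [x + t *: w] to these constraints. *)
Lemma graph_extend (A : set (V * R)) (w : V) : A !=set0 -> linear_graph A ->
    (forall u, A u -> u.2 <= p u.1) ->
  exists c, linear_graph [set (u.1 + t *: w, u.2 + t * c) | u in A & t in setT]
    /\ forall u t, A u -> u.2 + t * c <= p (u.1 + t *: w).
Proof.
move=> [a0 Aa0] Alin Ap.
pose L := [set u.2 - p (u.1 - w) | u in A].
have LU u v : A u -> A v -> u.2 - p (u.1 - w) <= p (v.1 + w) - v.2.
  move=> Au Av; have := Ap _ (Alin 1 _ _ Au Av); rewrite /= scale1r mul1r.
  have := pD (u.1 - w) (v.1 + w).
  by rewrite addrACA addNr addr0; lra.
have hL : has_sup L.
  split; first by exists (a0.2 - p (a0.1 - w)), a0.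
  by exists (p (a0.1 + w) - a0.2) => _ [u Au <-]; exact: LU.
exists (sup L); split.
  move=> a _ _ [u Au [t _ <-]] [v Av [s _ <-]] /=.
  exists (a *: u.1 + v.1, a * u.2 + v.2); first exact: Alin.
  exists (a * t + s) => //=.
  rewrite scalerDl mulrDl !scalerDr !mulrDr scalerA mulrA.
  by rewrite addrACA [X in (_, X)]addrACA.
have cL u : A u -> u.2 - p (u.1 - w) <= sup L.
  by move=> Au; apply: ub_le_sup; [exact: hL.2|exists u].
have cU u : A u -> sup L <= p (u.1 + w) - u.2.
  by move=> Au; apply: ge_sup => [|_ [v Av <-]]; [exact: hL.1|exact: LU].
have A0 : A (0, 0).
  by have := Alin (-1) _ _ Aa0 Aa0; rewrite scaleN1r mulN1r !addNr.
have AZ a u : A u -> A (a *: u.1, a * u.2).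
  by move=> Au; have := Alin a _ _ Au A0; rewrite /= !addr0.
move=> u t Au; case: (ltgtP t 0) => [t0|t0|->]; last first.
- by rewrite mul0r scale0r !addr0; exact: Ap.
- have := cU _ (AZ t^-1 u Au); rewrite /= => /(ler_wpM2l (ltW t0)).
  rewrite mulrBr -pZ// scalerDr scalerA mulrA divff ?gt_eqF// scale1r mul1r.
  by lra.
- have nt0 : 0 < - t by rewrite oppr_gt0.
  have := cL _ (AZ (- t)^-1 u Au); rewrite /= => /(ler_wpM2l (ltW nt0)).
  rewrite mulrBr -pZ// scalerBr scalerA mulrA divff ?gt_eqF// scale1r mul1r.
  by rewrite scaleNr opprK; lra.
Qed.

(** Prescribing the functional by its graph lets it be given along an arbitrary
    linear map instead of on a subspace: domination by [p] alone forces the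
    graph to be that of a function, since [p 0] bounds both [r] and [- r]
    when [(0, r)] lies in it. *)
Theorem hahn_banach (G : set (V * R)) : G !=set0 -> linear_graph G ->
    (forall u, G u -> u.2 <= p u.1) ->
  exists g : {linear V -> R^o}, (forall x, g x <= p x) /\
    forall u, G u -> g u.1 = u.2.
Proof.
move=> G0 Glin Gp.
(* The clause on [G] is conditional so that the empty chain has an upper
   bound. *)
pose P (A : set (V * R)) := [/\ linear_graph A,
  forall u, A u -> u.2 <= p u.1 & A !=set0 -> G `<=` A].
have [A [[Alin Ap AG] Amax]] : exists A, P A /\ forall B, A `<` B -> ~ P B.
  apply: Zorn_bigcup => F FP Ftot; split.
  - move=> a u v [B FB Bu] [C FC Cv]; have [BC|CB] := Ftot _ _ FB FC.
      by exists C => //; have [+ _ _] := FP _ FC; apply=> //; exact: BC.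
    by exists B => //; have [+ _ _] := FP _ FB; apply=> //; exact: CB.
  - by move=> u [B FB Bu]; have [_ + _] := FP _ FB; exact.
  - move=> [u [B FB Bu]] v Gv; exists B => //.
    by have [_ _ +] := FP _ FB; apply=> //; exists u.
have A0 : A !=set0.
  apply/set0P/eqP => A0; apply: (Amax G); last by split=> // _.
  by rewrite A0; split; [exact: sub0set|case: G0 => u Gu /(_ _ Gu) []].
have {}AG := AG A0.
have dom w : exists r, A (w, r).
  apply: contrapT => /forallNP nw.
  have [c [Blin Bp]] := graph_extend A w A0 Alin Ap.
  set B := [set _ | _ in _ & _ in _] in Blin.
  have AB : A `<=` B.
    by move=> [x r] Axr; exists (x, r) => //; exists 0 => //=;
      rewrite scale0r mul0r !addr0.
  apply: (Amax B).
    split=> // BA; have [u Au] := A0.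
    have /BA Ac : B (u.1 + w, u.2 + c).
      by exists u => //; exists 1 => //; rewrite scale1r mul1r.
    apply: (nw c); have := Alin (-1) _ _ Au Ac.
    by rewrite /= scaleN1r mulN1r !addKr.
  split=> //; first by move=> _ [u Au [t _ <-]]; exact: Bp.
  by move=> _; exact: subset_trans AB.
have fct w r s : A (w, r) -> A (w, s) -> r <= s.
  move=> Ar As; have := Alin (-1) _ _ As Ar; rewrite /= scaleN1r mulN1r addNr.
  move=> /[dup] /Ap/= rs Ars; have := Ap _ (Alin 1 _ _ Ars Ars) => /=.
  have p00 : p 0 = 2 * p 0 by rewrite -pZ// scaler0.
  by move: rs; lra.
have [g Ag] := choice dom.
have gE w r : A (w, r) -> g w = r.
  by move=> Aw; apply/eqP; rewrite eq_le (fct w)// (fct w).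
have glin : linear (g : V -> R^o).
  by move=> a x y; apply: gE; exact: (Alin a (x, g x) (y, g y)).
pose gl : {linear V -> R^o} :=
  HB.pack (g : V -> R^o) (GRing.isLinear.Build R V R^o *:%R g glin).
by exists gl; split=> [x|[x r] /AG/gE//]; exact: (Ap (x, g x)).
Qed.

End HahnBanach.

(** * Baire category and disjoint open sets *)

Section Topology.
Variable T : topologicalType.

Lemma nested_compact (C : nat -> set T) : compact (C 0) ->
    (forall n, closed (C n)) -> (forall n, C n !=set0) ->
    (forall n, C n.+1 `<=` C n) -> \bigcap_n C n !=set0.
Proof.
move=> C0 Ccl Cne Cdec.
have Cle m n : (m <= n)%N -> C n `<=` C m.
  elim: n => [|n IHn]; first by rewrite leqn0 => /eqP ->.
  rewrite leq_eqVlt => /predU1P[-> //|]; rewrite ltnS => /IHn.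
  exact: subset_trans (Cdec n).
pose F := filter_from [set: nat] C.
have FF : ProperFilter F.
  apply: filter_from_proper => [|n _]; last exact: Cne.
  apply: filter_from_filter; first by exists 0%N.
  move=> m n _ _; exists (maxn m n) => // t Ct.
  by split; apply: Cle Ct; rewrite ?leq_maxl ?leq_maxr.
have [|t [_ clt]] := C0 F FF; first by exists 0%N.
exists t => n _; apply: Ccl => B Bt; apply: clt => //.
by exists n.
Qed.

(** Compactness gives regularity, so that an open set can be shrunk to one whose
    closure avoids a prescribed nowhere dense set. Doing this for all sets of a
    countable family yields nested compact sets, and a common point of them
    belongs to no member of the family. *)
Lemma baire_compact (U : set T) : compact [set: T] -> hausdorff_space T ->
  open U -> U !=set0 -> ~ first_category U.
Proof.
move=> cT hT oU U0 [F nF UF].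
have [f fP] : exists f : nat * set T -> set T, forall nV, open nV.2 ->
    nV.2 !=set0 -> [/\ open (f nV), f nV !=set0 &
      closure (f nV) `<=` nV.2 `\` F nV.1].
  suff /choice[f fP] (nV : nat * set T) : exists W, open nV.2 ->
      nV.2 !=set0 -> [/\ open W, W !=set0 & closure W `<=` nV.2 `\` F nV.1].
    by exists f.
  case: nV => n V /=.
  have [[oV V0]|nV] := pselect (open V /\ V !=set0); last first.
    by exists set0 => oV V0; case: nV.
  have [x [Vx nFx]] : exists x, V x /\ ~ closure (F n) x.
    apply: contrapT => /forallNP h; case: V0 => x Vx.
    have : interior (closure (F n)) x.
      rewrite /interior; apply: filterS (open_nbhs_nbhs (conj oV Vx)) => y Vy.
      by apply: contrapT => nFy; apply: (h y).
    by rewrite nF.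
  have nx : nbhs x (V `&` ~` closure (F n)).
    apply: open_nbhs_nbhs; split=> //; apply: openI => //.
    by apply: closed_openC; exact: closed_closure.
  have [W Wx WV] := compact_regular hT cT filterT nx.
  exists W^° => _ _; split; first exact: open_interior.
    by exists x.
  move=> y /(closureS (@interior_subset _ W))/WV[Vy nFy]; split=> //.
  by move=> Fy; apply: nFy; exact: subset_closure.
pose V := fix V n := if n is m.+1 then f (m, V m) else U.
have Vo n : open (V n) /\ V n !=set0.
  by elim: n => //= n [oV V0]; have [] := fP (n, V n) oV V0.
have VS n : closure (V n.+1) `<=` V n `\` F n.
  by have [oV V0] := Vo n; have [] := fP (n, V n) oV V0.
have [||||x Vx] := @nested_compact (fun n => closure (V n)).
- by apply: subclosed_compact cT _ => //; exact: closed_closure.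
- by move=> n; exact: closed_closure.
- by move=> n; have [_ [y Vy]] := Vo n; exists y; exact: subset_closure.
- by move=> n y /VS[Vy _]; exact: subset_closure.
have Ux : U x by have /VS[] := Vx 1%N I.
by move: (Ux); rewrite UF => -[n _ Fx]; have /VS[] := Vx n.+1 I.
Qed.

Lemma nonmeager_dense_open (A : set T) : ~ first_category A ->
  exists U, [/\ open U, U !=set0 &
    forall V, open V -> V `<=` U -> V !=set0 -> (A `&` V) !=set0].
Proof.
move=> nA; exists (interior (closure A)); split.
- exact: open_interior.
- apply/set0P/eqP => cA; apply: nA; exists (fun=> A) => //.
  by rewrite bigcup_const.
- move=> V oV VA [x Vx]; apply: (interior_subset (VA x Vx)).
  exact: open_nbhs_nbhs.
Qed.

(** A Hausdorff space without isolated points leaves room, inside every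
    non-empty open set, for two disjoint non-empty open sets; splitting the
    second one again and again gives the sequence. *)
Lemma disjoint_open_sequence (U : set T) : hausdorff_space T ->
    (forall t : T, ~ open [set t]) -> open U -> U !=set0 ->
  exists W : nat -> set T, [/\ forall n, open (W n), forall n, W n !=set0,
    forall n, W n `<=` U & trivIset setT W].
Proof.
rewrite open_hausdorff => hT pT oU U0.
have split2 V : open V -> V !=set0 -> exists AB : set T * set T,
    [/\ open AB.1 /\ open AB.2, AB.1 !=set0, AB.2 !=set0,
    AB.1 `<=` V /\ AB.2 `<=` V & AB.1 `&` AB.2 = set0].
  move=> oV [x Vx].
  have [y [Vy yx]] : exists y, V y /\ y != x.
    apply: contrapT => /forallNP h; apply: (pT x).
    suff <- : V = [set x] by [].
    apply/seteqP; split=> [y Vy|_ -> //]; apply/eqP/negP => /negP yx.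
    exact: (h y).
  have [[A B] /= [Ay Bx] [oA oB /eqP AB0]] := hT _ _ yx.
  exists (A `&` V, B `&` V); split=> /=; rewrite ?inE in Ay Bx.
  - by split; exact: openI.
  - by exists y.
  - by exists x.
  - by split; exact: subIsetr.
  - by rewrite setIACA AB0 set0I.
have [f fP] : exists f : set T -> set T * set T, forall V,
    open V -> V !=set0 ->
    [/\ open (f V).1 /\ open (f V).2, (f V).1 !=set0, (f V).2 !=set0,
    (f V).1 `<=` V /\ (f V).2 `<=` V & (f V).1 `&` (f V).2 = set0].
  suff /choice[f fP] (V : set T) : exists AB : set T * set T,
      open V -> V !=set0 ->
      [/\ open AB.1 /\ open AB.2, AB.1 !=set0, AB.2 !=set0,
      AB.1 `<=` V /\ AB.2 `<=` V & AB.1 `&` AB.2 = set0].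
    by exists f.
  have [[oV V0]|nV] := pselect (open V /\ V !=set0).
    by have [AB ABP] := split2 V oV V0; exists AB.
  by exists (set0, set0) => oV V0; case: nV.
pose V := fix V n := if n is m.+1 then (f (V m)).2 else U.
have Vo n : open (V n) /\ V n !=set0.
  by elim: n => //= n [oV V0]; have [[]] := fP (V n) oV V0.
have VS n : V n.+1 `<=` V n.
  by have [oV V0] := Vo n; have [_ _ _ []] := fP (V n) oV V0.
have Vle m n : (m <= n)%N -> V n `<=` V m.
  elim: n => [|n IHn]; first by rewrite leqn0 => /eqP ->.
  rewrite leq_eqVlt => /predU1P[-> //|]; rewrite ltnS => /IHn.
  exact: subset_trans (VS n).
have WV n : (f (V n)).1 `<=` V n.
  by have [oV V0] := Vo n; have [_ _ _ []] := fP (V n) oV V0.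
have Wlt m n : (m < n)%N -> (f (V m)).1 `&` (f (V n)).1 = set0.
  move=> mn; rewrite -subset0 => t [Wm /WV/(Vle _ _ mn)/= Wn].
  have [oV V0] := Vo m; have [_ _ _ _ f0] := fP (V m) oV V0.
  by have : ((f (V m)).1 `&` (f (V m)).2) t by []; rewrite f0.
exists (fun n => (f (V n)).1); split=> [n|n|n|].
- by have [oV V0] := Vo n; have [[]] := fP (V n) oV V0.
- by have [oV V0] := Vo n; have [] := fP (V n) oV V0.
- exact: subset_trans (Vle 0%N n _).
- apply/trivIsetP => m n _ _; rewrite neq_ltn => /orP[|nm]; first exact: Wlt.
  by rewrite setIC; exact: Wlt.
Qed.

End Topology.

Lemma dense_sequence (R : realType) (V : normedModType R) : separable V ->
  exists s : nat -> V, forall v e, 0 < e -> exists n, `|v - s n| < e.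
Proof.
move=> [D /countable_injP[f finj] Dd].
exists (fun n => xget 0 [set v | D v /\ f v = n]) => v e e0.
have [||w [vw Dw]] := Dd (ball v e).
- by exists v; exact: ballxx.
- exact: ball_open.
exists (f w); case: xgetP => [u _ [Du fu]|/(_ w)]; last by case.
suff -> : u = w by move: vw; rewrite -ball_normE.
by apply: finj; rewrite ?inE.
Qed.

(** * The dual ball and its extreme points *)

Section DualBall.
Variables (R : realType) (X : normedModType R).

Lemma bounded_linear_dual (g : X -> R^o) (c : R) : linear g ->
    (forall x, `|g x| <= c * `|x|) ->
  exists u : dual_space X, forall x, u x = g x.
Proof.
move=> glin gc.
pose f : {linear X -> R^o} :=
  HB.pack g (GRing.isLinear.Build R X R^o *:%R g glin).
have gP : g \in @dual_pred R X.
  apply/mem_set; split=> //; apply: (@bounded_linear_continuous _ _ _ f).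
  apply/linear_boundedP; exists c; split; first exact: num_real.
  by move=> r /ltW cr x; apply: le_trans (gc x) _; rewrite ler_wpM2r.
by exists (Dual gP).
Qed.

Lemma dual_spaceN (u : dual_space X) x : (- u) x = - u x.
Proof. by []. Qed.

Lemma dual_spaceDZ (s t : R) (u v : dual_space X) x :
  (s *: u + t *: v) x = s * u x + t * v x.
Proof. by []. Qed.

Lemma dual_ballP {u : dual_space X} :
  dual_ball X u <-> forall x, `|u x| <= `|x|.
Proof.
split=> [|h]; first exact: dual_ball_le.
apply: ge_sup => [|_ [x /= x1 <-]]; last exact: le_trans (h x) x1.
by exists `|u 0|, 0 => //=; rewrite normr0.
Qed.

Lemma dual_ball_homo (u : dual_space X) :
  (forall x, u x <= `|x|) -> dual_ball X u.
Proof.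
move=> h; apply/dual_ballP => x; rewrite ler_norml h andbT.
by rewrite lerNl -linearN -[leRHS]normrN; exact: h.
Qed.

Lemma dual_ext (u v : dual_space X) : (forall x, u x = v x) -> u = v.
Proof. by move=> uv; apply/val_inj/funext. Qed.

(** The ball embeds into the product of the intervals from [- `|x|] to [`|x|],
    which is compact. A cluster point in the product is linear, because it is
    approximated by linear functionals at any three points. *)
Lemma dual_ball_compact : compact (dual_ball X).
Proof.
pose D (u : dual_space X) : {ptws X -> R^o} := dual_fun u.
have cP := @tychonoff X (fun=> R^o) _ (fun x => @segment_compact R (- `|x|) `|x|).
move=> F FF FB.
have [|g [gB clg]] := cP (D @ F).
  suff : F [set u | forall x : X, `[- `|x|, `|x|]%classic (u x)] by [].
  apply: filterS FB => u /dual_ballP uB x /=.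
  by have := uB x; rewrite ler_norml in_itv.
have FD (S : set (dual_space X)) : F S -> (D @ F) (D @` S).
  move=> FS; suff : F [set v | (D @` S) (D v)] by [].
  by apply: filterS FS => v Sv; exists v.
have ev (x : X) (e : R) : 0 < e ->
    nbhs g [set h : {ptws X -> R^o} | `|(g x : R^o) - h x| < e].
  move=> e0; apply: (@proj_continuous X (fun=> R^o) x g [set r | `|g x - r| < e]).
  exact: (@cvgr_dist_lt R R^o _ _ _ id (g x) cvg_id e e0).
have glin : linear g.
  move=> a x y; apply/eqP; rewrite -subr_eq0 -normr_le0.
  apply/ler_addgt0Pr => e e0; rewrite add0r.
  have d0 : 0 < e / (2 + `|a|) by rewrite divr_gt0// ltr_wpDr.
  have [_ [[v _ <-] [[v1 v2] v3]]] := clg _ _ (FD _ FB)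
    (filterI (filterI (ev x _ d0) (ev y _ d0)) (ev (a *: x + y) _ d0)).
  have lv : v (a *: x + y) = a * v x + v y by exact: linearP.
  have -> : g (a *: x + y) - (a *: g x + g y) = ((g (a *: x + y) : R) -
      v (a *: x + y)) - ((g y : R) - v y) - a * ((g x : R) - v x).
    transitivity ((g (a *: x + y) : R) - (a * (g x : R) + (g y : R))) => //.
    by rewrite lv; ring.
  apply: le_trans (ler_normB _ _) _; rewrite normrM.
  have h1 := ler_normB (g (a *: x + y) - v (a *: x + y)) (g y - v y).
  have h2 : `|a| * `|g x - v x| <= `|a| * (e / (2 + `|a|)).
    by rewrite ler_wpM2l// ltW.
  have -> : e = 2 * (e / (2 + `|a|)) + `|a| * (e / (2 + `|a|)).
    by field; rewrite gt_eqF// ltr_wpDr.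
  by move: v1 v2 v3 h1 h2; rewrite /=; lra.
have gle x : `|g x| <= 1 * `|x|.
  by have := gB x; rewrite /= in_itv/= -ler_norml mul1r.
have [u ug] := bounded_linear_dual _ _ glin gle.
have Dug : D u = g by exact/funext.
exists u; split; first by apply/dual_ballP => x; rewrite ug -[leRHS]mul1r.
move=> A B FA [_ [[C oC <-]] uC CB].
have [h [[v Av <-] Ch]] : (D @` A) `&` C !=set0.
  apply: clg; first exact: FD.
  by apply: open_nbhs_nbhs; split=> //; rewrite -Dug.
by exists v; split=> //; exact: CB.
Qed.

Lemma dual_cvg (F : set_system (dual_space X)) (u : dual_space X) : Filter F ->
    (forall x (e : R), 0 < e -> F [set v : dual_space X | `|u x - v x| < e]) ->
  F --> u.
Proof.
move=> FF Fu.
have cD : (@dual_fun R X : dual_space X -> {ptws X -> R^o}) @ F -->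
    (@dual_fun R X u : {ptws X -> R^o}).
  apply/pointwise_cvgP => x; apply/(@cvgrPdist_lt R R^o) => e e0.
  exact: Fu.
move=> A [_ [[C oC <-]] uC CA].
have : nbhs (@dual_fun R X u : {ptws X -> R^o}) C by apply: open_nbhs_nbhs; split.
move=> /cD FC; have {FC} : F [set v | C (@dual_fun R X v)] by [].
by apply: filterS => v; exact: CA.
Qed.

Lemma dual_hausdorff : hausdorff_space (dual_space X).
Proof.
move=> u v clu; apply: dual_ext => x.
apply: (@norm_hausdorff R R^o) => A B Au Bv.
have [w [Aw Bw]] := clu _ _ (@dual_eval_continuous R X x u A Au)
  (@dual_eval_continuous R X x v B Bv).
by exists (w x).
Qed.

Lemma ex_closure_sub : ex_closure X `<=` dual_ball X.
Proof. by move=> u /ex_closure_le/dual_ballP. Qed.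

Lemma extreme_point_opp (u : dual_space X) :
  extreme_points (dual_ball X) u -> extreme_points (dual_ball X) (- u).
Proof.
have oppB v : dual_ball X v -> dual_ball X (- v).
  move=> /dual_ballP vB; apply/dual_ballP => x.
  by rewrite dual_spaceN normrN; exact: vB.
move=> [uB ue]; split=> [|y z t yB zB t01 uE]; first exact: oppB.
have [|yu zu] := ue _ _ t (oppB _ yB) (oppB _ zB) t01; last first.
  by rewrite -[y]opprK -[z]opprK yu zu.
by rewrite !scalerN -opprD -uE opprK.
Qed.

Definition face (F : set (dual_space X)) :=
  [/\ F `<=` dual_ball X, compact F, F !=set0 &
    forall u y z (t : R), F u -> dual_ball X y -> dual_ball X z -> 0 < t < 1 ->
      u = t *: y + (1 - t) *: z -> F y /\ F z].

Definition maximizers (F : set (dual_space X)) (x : X) : set (dual_space X) :=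
  [set u | F u /\ forall v, F v -> v x <= u x].

Lemma face_maximizers F x : face F -> face (maximizers F x).
Proof.
move=> [FB cF F0 Fe].
have [c /set_mem Fc cmax] : exists2 c : dual_space X, c \in F &
    forall v : dual_space X, v \in F -> (v x : R) <= c x.
  apply: (@compact_EVT_max _ R (fun v : dual_space X => v x : R)) => //.
  exact/continuous_subspaceT/dual_eval_continuous.
have {}cmax v : F v -> v x <= c x by move=> Fv; exact/cmax/mem_set.
split; first by move=> u [/FB].
- rewrite (_ : maximizers F x = F `&` [set u | c x <= u x]); last first.
    apply/seteqP; split=> [u [Fu um]|u [Fu um]]; split=> //=; first exact: um.
    by move=> v /cmax vc; exact: le_trans vc um.
  apply: compact_closedI => //.
  apply: (@closed_comp _ R^o (fun u : dual_space X => u x) [set r | c x <= r]).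
    by move=> u _; exact: dual_eval_continuous.
  exact: closed_ge.
- by exists c; split.
- move=> u y z t [Fu um] yB zB t01 uE.
  have [Fy Fz] := Fe _ _ _ _ Fu yB zB t01 uE.
  case/andP: t01 => t0 t1.
  have uxE : u x = t * y x + (1 - t) * z x by rewrite uE dual_spaceDZ.
  have := um _ Fy; have := um _ Fz; rewrite uxE => zl yl.
  have yz : y x = z x.
    apply/eqP; rewrite eq_le -(ler_pM2l t0) -[X in _ && X](@ler_pM2l _ (1 - t)).
      by apply/andP; split; nra.
    by rewrite subr_gt0.
  have ux : u x = y x by rewrite uxE -yz; ring.
  by split; split=> // v /um; rewrite ux -?yz.
Qed.

Lemma face_ball (x : X) : face [set u | dual_ball X u /\ u x = `|x|].
Proof.
split.
- by move=> u [].
- rewrite (_ : mkset _ = dual_ball X `&` [set u | u x = `|x|]) //.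
  apply: compact_closedI; first exact: dual_ball_compact.
  apply: (@closed_comp _ R^o (fun u : dual_space X => u x) [set `|x|]).
    by move=> u _; exact: dual_eval_continuous.
  exact: accessible_closed_set1 (hausdorff_accessible (@norm_hausdorff _ _)) _.
- have [|||||g [gle gx]] := @hahn_banach R X (fun y => `|y|) _ _
    [set (a *: x, a * `|x|) | a in [set: R]].
  + exact: ler_normD.
  + by move=> a y a0; rewrite normrZ gtr0_norm.
  + by exists (0 *: x, 0 * `|x|), 0.
  + move=> a _ _ [b _ <-] [c _ <-] /=; exists (a * b + c) => //.
    by rewrite scalerDl mulrDl scalerA mulrA.
  + by move=> _ [a _ <-] /=; rewrite normrZ ler_wpM2r// ler_norm.
  have [|u ug] := bounded_linear_dual g 1 (linearP g).
    move=> y; rewrite mul1r ler_norml gle andbT lerNl -linearN -[leRHS]normrN.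
    exact: gle.
  exists u; split; first by apply: dual_ball_homo => y; rewrite ug.
  by rewrite ug (gx (x, `|x|))//=; exists 1 => //; rewrite scale1r mul1r.
- move=> u y z t [uB ux] yB zB /andP[t0 t1] uE.
  have yx : y x <= `|x| by apply: le_trans (ler_norm _) (dual_ball_le yB x).
  have zx : z x <= `|x| by apply: le_trans (ler_norm _) (dual_ball_le zB x).
  have uxE : u x = t * y x + (1 - t) * z x by rewrite uE dual_spaceDZ.
  rewrite ux in uxE.
  by split; split=> //; nra.
Qed.

(** Starting from the face where the evaluation at [x] is maximal, maximise
    successively the evaluations at the points of a dense sequence. On the
    intersection of these faces all evaluations are constant; it is therefore a
    single point, and this point is extreme. *)
Lemma extreme_norming (x : X) : separable X ->
  exists2 u, extreme_points (dual_ball X) u & u x = `|x|.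
Proof.
move=> /dense_sequence[s sP].
pose F := fix F n := if n is m.+1 then maximizers (F m) (s m)
  else [set u | dual_ball X u /\ u x = `|x|].
have FF n : face (F n).
  by elim: n => [|n IHn]; [exact: face_ball|exact: face_maximizers].
have [||||u Fu] := nested_compact _ F.
- by have [] := FF 0%N.
- by move=> n; apply: compact_closed; [exact: dual_hausdorff|case: (FF n)].
- by move=> n; have [] := FF n.
- by move=> n v [].
exists u; last by have [] := Fu 0%N I.
split; first by have [] := Fu 0%N I.
have uniq v : (forall n, F n v) -> v = u.
  move=> Fv; apply: dual_ext => y; apply/eqP; rewrite -subr_eq0 -normr_le0.
  apply/ler_addgt0Pr => e e0; rewrite add0r.
  have [n yn] := sP y (e / 2) (divr_gt0 e0 (ltr0Sn _ 1)).
  have sE : v (s n) = u (s n).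
    have [/= Fv' vm] := Fv n.+1; have [/= Fu' um] := Fu n.+1 I.
    by apply/eqP; rewrite eq_le um// vm.
  have -> : v y - u y = v (y - s n) - u (y - s n) by rewrite !linearB/= sE; ring.
  apply: le_trans (ler_normB _ _) _.
  have /dual_ball_le/(_ (y - s n)) : dual_ball X v by case: (Fv 0%N).
  have /dual_ball_le/(_ (y - s n)) : dual_ball X u by case: (Fu 0%N I).
  by move: yn; lra.
move=> y z t yB zB t01 uE.
have Fyz n : F n y /\ F n z.
  by have [_ _ _] := FF n; apply; [exact: Fu| | |exact: t01|exact: uE].
by split; apply: uniq => n; have [] := Fyz n.
Qed.

End DualBall.

(** * Milman's theorem and slices *)

Section Milman.
Variables (R : realType) (X : normedModType R) (L : set (dual_space X)).
Hypothesis LB : L `<=` dual_ball X.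

Let restr_bounded (A : set L) (f : linf R L) :
  (fun t => if t \in A then f t else 0 : R^o) \in @linf_pred R L.
Proof.
apply/linf_predP; exists `|f| => t; case: ifP => _; first exact: sup_norm_ge.
by rewrite normr0.
Qed.

Let restr A f : linf R L := Linf (restr_bounded A f).

Let one_bounded : (fun=> 1 : R^o) \in @linf_pred R L.
Proof. by apply/linf_predP; exists 1 => t; rewrite normr1. Qed.

Let one : linf R L := Linf one_bounded.

Let ev_bounded (x : X) :
  (fun u : L => set_val u x : R^o) \in @linf_pred R L.
Proof.
apply/linf_predP; exists `|x| => u; apply: dual_ball_le.
exact/LB/set_valP.
Qed.

Let ev (x : X) : linf R L := Linf (ev_bounded x).

(** The functional [u] is the barycenter of a finitely additive probability
    [mu] on [L], obtained by the Hahn-Banach theorem from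
    [u x <= sup_L x]. Conditioning [mu] on a set and on its complement writes
    [u] as a convex combination of two functionals of the ball, so extremality
    forces [u] to be the barycenter of every conditional probability as well.
    A set on which an evaluation at [x] stays above [u x] by a margin is
    therefore null: the sets of full measure form a filter on [L] that
    converges to [u]. *)
Theorem milman (u : dual_space X) :
    (forall x e, 0 < e -> exists2 v, L v & `|x| - e < v x) ->
  extreme_points (dual_ball X) u -> closure L u.
Proof.
move=> Lnorming [uB ue].
have [t0 _] : exists t : L, True.
  by have [v Lv _] := Lnorming 0 1 ltr01; exists (exist _ v (mem_set Lv)).
pose p (f : linf R L) := sup (range (f : L -> R)).
have p_ge (f : linf R L) t : f t <= p f.
  apply: ub_le_sup; last by exists t.
  exists `|f| => _ [s _ <-]; apply: le_trans (sup_norm_ge f s).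
  exact: ler_norm.
have p_le (f : linf R L) c : (forall t, f t <= c) -> p f <= c.
  by move=> fc; apply: ge_sup => [|_ [t _ <-] //]; exists (f t0), t0.
have [|||||Phi [Phip PhiG]] := @hahn_banach R (linf R L) p _ _
    [set (ev x, u x) | x in [set: X]].
- move=> f g; apply: p_le => t.
  by rewrite -[leLHS]/(f t + g t); apply: lerD; exact: p_ge.
- move=> a f a0; apply/eqP; rewrite eq_le; apply/andP; split.
    apply: p_le => t; rewrite -[leLHS]/(a * f t).
    by apply: ler_wpM2l (p_ge f t); exact: ltW.
  rewrite mulrC -ler_pdivlMr//; apply: p_le => t.
  by rewrite ler_pdivlMr// mulrC; exact: (p_ge (a *: f) t).
- by exists (ev 0, u 0), 0.
- move=> a _ _ [x _ <-] [y _ <-] /=; exists (a *: x + y) => //.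
  congr pair; last exact: linearP.
  by apply/val_inj/funext => t; exact: linearP.
- move=> _ [x _ <-] /=; apply: le_trans (ler_norm _) _.
  apply: le_trans (dual_ball_le uB x) _; apply/ler_addgt0Pr => e e0.
  have [v Lv xv] := Lnorming x e e0.
  have := p_ge (ev x) (exist _ v (mem_set Lv)).
  by rewrite -[leLHS]/(v x) => vp; move: xv; lra.
have Phiev x : Phi (ev x) = u x by apply: (PhiG (ev x, u x)); exists x.
have Phi_le (f g : linf R L) : (forall t, f t <= g t) -> Phi f <= Phi g.
  move=> fg; rewrite -subr_le0 -linearB; apply: le_trans (Phip _) _.
  by apply: p_le => t; rewrite -[leLHS]/(f t - g t) subr_le0.
have Phi1 : Phi one = 1.
  apply/eqP; rewrite eq_le; apply/andP; split.
    by apply: le_trans (Phip _) _; exact: p_le.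
  rewrite -lerN2 -linearN; apply: le_trans (Phip _) _; exact: p_le.
pose mu A := Phi (restr A one).
have restrC A f : restr A f + restr (~` A) f = f.
  apply/val_inj/funext => t.
  rewrite -[LHS]/((if t \in A then f t else 0) +
    (if t \in ~` A then f t else 0)) in_setC.
  by case: (t \in A); rewrite /= ?addr0 ?add0r.
have muC A : mu A + mu (~` A) = 1 by rewrite -linearD restrC.
have mu_ge0 A : 0 <= mu A.
  rewrite -(linear0 Phi); apply: Phi_le => t.
  by rewrite -[leRHS]/(if t \in A then 1 else 0 : R); case: ifP.
have phi_le A x : `|Phi (restr A (ev x))| <= mu A * `|x|.
  rewrite ler_norml mulrC -mulNr.
  have muZ c : c * mu A = Phi (c *: restr A one) by rewrite linearZ.
  rewrite !muZ; have evx t : - `|x| <= ev x t <= `|x|.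
    by rewrite -ler_norml; exact/dual_ball_le/LB/set_valP.
  apply/andP; split; apply: Phi_le => t.
    rewrite -[leLHS]/(- `|x| * (if t \in A then 1 else 0)).
    rewrite -[leRHS]/(if t \in A then ev x t else 0).
    by case: ifP; rewrite ?mulr0 ?mulr1//; case/andP: (evx t).
  rewrite -[leRHS]/(`|x| * (if t \in A then 1 else 0)).
  rewrite -[leLHS]/(if t \in A then ev x t else 0).
  by case: ifP; rewrite ?mulr0 ?mulr1//; case/andP: (evx t).
have phi_lin A : linear (fun x => Phi (restr A (ev x)) : R^o).
  move=> a x y; rewrite -linearP; congr (Phi _); apply/val_inj/funext => t.
  rewrite -[LHS]/(if t \in A then set_val t (a *: x + y) else 0).
  rewrite -[RHS]/(a * (if t \in A then set_val t x else 0) +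
    (if t \in A then set_val t y else 0)).
  by case: ifP => _; rewrite ?mulr0 ?addr0// linearP.
have null x d : 0 < d -> mu [set t : L | u x + d <= set_val t x] = 0.
  move=> d0; set A := mkset _; apply/eqP/negPn/negP => muA.
  have m0 : 0 < mu A by rewrite lt_neqAle eq_sym muA mu_ge0.
  have phix : (u x + d) * mu A <= Phi (restr A (ev x)).
    have -> c : c * mu A = Phi (c *: restr A one) by rewrite linearZ.
    apply: Phi_le => t; rewrite -[leRHS]/(if t \in A then set_val t x else 0).
    rewrite -[leLHS]/((u x + d) * (if t \in A then 1 else 0)).
    by case: ifP; rewrite ?mulr0// mulr1 inE.
  have uE y : u y = Phi (restr A (ev y)) + Phi (restr (~` A) (ev y)).
    by rewrite -linearD restrC Phiev.
  have [mC|mC] := eqVneq (mu (~` A)) 0.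
    have := phi_le (~` A) x; rewrite mC mul0r normr_le0 => /eqP phiC.
    have mA : mu A = 1 by rewrite -(muC A) mC addr0.
    by move: phix; rewrite mA uE phiC addr0; lra.
  have mC0 : 0 < mu (~` A) by rewrite lt_neqAle eq_sym mC mu_ge0.
  (* The barycenter of the measure conditioned on [B]. *)
  have cond B : 0 < mu B -> exists2 v : dual_space X, dual_ball X v &
      forall y, mu B * v y = Phi (restr B (ev y)).
    move=> B0.
    have [||v vE] := @bounded_linear_dual R X
        (fun y => (mu B)^-1 * Phi (restr B (ev y))) 1.
    - move=> a y z; rewrite (phi_lin B a y z) /GRing.scale/=.
      by rewrite mulrDr mulrCA.
    - move=> y; rewrite normrM gtr0_norm ?invr_gt0// mul1r.
      by rewrite mulrC ler_pdivrMr// mulrC.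
    exists v => [|y]; last by rewrite vE mulVKf// gt_eqF.
    apply/dual_ballP => y; rewrite vE normrM gtr0_norm ?invr_gt0//.
    by rewrite mulrC ler_pdivrMr// mulrC.
  have [v vB vE] := cond _ m0; have [w wB wE] := cond _ mC0.
  have [||vu _] := ue v w (mu A) vB wB.
  - by rewrite m0 -(muC A) ltrDl.
  - apply: dual_ext => y; rewrite dual_spaceDZ vE.
    by rewrite (_ : 1 - mu A = mu (~` A)) ?wE// -(muC A) addrAC subrr add0r.
  by move: phix; rewrite -vE vu; nra.
pose F : set_system (dual_space X) :=
  fun S => mu [set t : L | ~ S (set_val t)] = 0.
have mu_sub A B C : A `<=` B `|` C -> mu B = 0 -> mu C = 0 -> mu A = 0.
  move=> ABC B0 C0; apply/eqP; rewrite eq_le mu_ge0 andbT.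
  rewrite -[leRHS](addr0 0) -{1}B0 -C0 -linearD; apply: Phi_le => t.
  rewrite -[leLHS]/(if t \in A then 1 else 0 : R).
  rewrite -[leRHS]/((if t \in B then 1 else 0) + (if t \in C then 1 else 0)).
  case: ifPn => [/set_mem/ABC[/mem_set->|/mem_set->]|_].
  - by rewrite lerDl; case: ifP.
  - by rewrite lerDr; case: ifP.
  - by rewrite addr_ge0//; case: ifP.
have mu0 : mu set0 = 0.
  rewrite /mu -(linear0 Phi); congr (Phi _); apply/val_inj/funext => t.
  by rewrite -[LHS]/(if t \in set0 then 1 else 0 : R) in_set0.
have FF : Filter F.
  split.
  - by rewrite /F (_ : mkset _ = set0)//; apply/seteqP; split=> // t [].
  - move=> S S' FS FS'; apply: (mu_sub _ _ _ _ FS FS') => t /=.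
    by move=> /not_andP[]; [left|right].
  - move=> S S' SS' FS; apply: (mu_sub _ _ _ _ FS FS) => t /= nS'.
    by left=> /SS'.
have Fu : F --> u.
  apply: (@dual_cvg R X F u FF) => x e e0.
  apply: (mu_sub _ _ _ _ (null x e e0) (null (- x) e e0)) => t.
  move=> /= /negP; rewrite -leNgt ler_normr => /orP[] h; [right|left].
    by rewrite /= !linearN; move: h; lra.
  by rewrite /=; move: h; lra.
move=> B /Fu FB; apply: contrapT => LB0.
suff : mu setT = 0.
  have := muC setT; rewrite setCT mu0 addr0 => -> /eqP.
  by rewrite oner_eq0.
rewrite -[RHS]FB; congr mu; apply/seteqP; split=> // t _ Bt; apply: LB0.
by exists (set_val t); split=> //; exact: set_valP.
Qed.

End Milman.

Section Slices.
Variables (R : realType) (X : normedModType R).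

(** If every slice of [ex_closure X] met the complement of [U], the part of
    [ex_closure X] outside [U] would still be norming, and its closure, which
    is disjoint from [U], would contain every extreme point. *)
Lemma slice_in_open (U : set (dual_space X)) : (exists x : X, x != 0) ->
    open U -> (ex_closure X `&` U) !=set0 ->
  exists x (a : R), [/\ `|x| = 1, 0 < a &
    forall u, ex_closure X u -> 1 - a < u x -> U u].
Proof.
move=> [x0 x00] oU [u [Ku Uu]].
have [v [ve Uv]] : (extreme_points (dual_ball X) `&` U) !=set0.
  by apply: Ku; exact: open_nbhs_nbhs.
apply: contrapT => /forallNP noslice.
pose L := ex_closure X `&` ~` U.
have slice x a : `|x| = 1 -> 0 < a -> exists2 w, L w & 1 - a < w x.
  move=> x1 a0; apply: contrapT => nw; apply: (noslice x); exists a.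
  split=> // w Kw wx; apply: contrapT => nUw; apply: nw.
  by exists w => //; split.
have LB : L `<=` dual_ball X by move=> w [/ex_closure_sub].
have : closure L v.
  apply: milman => // x e e0; have [->|xn0] := eqVneq x 0.
    have x01 : `| `|x0|^-1 *: x0| = 1.
      by rewrite normrZ gtr0_norm ?invr_gt0 ?normr_gt0// mulVf// normr_eq0.
    have [w Lw _] := slice _ 1 x01 ltr01.
    by exists w => //; rewrite normr0 linear0; lra.
  have xp : 0 < `|x| by rewrite normr_gt0.
  have x1 : `| `|x|^-1 *: x| = 1.
    by rewrite normrZ gtr0_norm ?invr_gt0// mulVf// gt_eqF.
  have [w Lw] := slice _ (e / `|x|) x1 (divr_gt0 e0 xp).
  have -> : w (`|x|^-1 *: x) = `|x|^-1 * w x by rewrite linearZ.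
  move=> wx; exists w => //.
  have -> : w x = `|x| * (`|x|^-1 * w x) by rewrite mulVKf// gt_eqF.
  apply: le_lt_trans (_ : `|x| * (1 - e / `|x|) < _); last first.
    by rewrite ltr_pM2l.
  by rewrite mulrBr mulr1 mulrCA divff ?gt_eqF// mulr1.
move=> /(_ U (open_nbhs_nbhs (conj oU Uv)))[w [[_ nUw] Uw]].
exact: nUw.
Qed.

End Slices.

(** * Subtypes and essential suprema modulo meager sets *)

Section SubtypeTopology.
Variables (T : topologicalType) (A : set T).

Lemma set_type_compact : compact A -> compact [set: A].
Proof.
move=> cA F FF _; pose G : set_system T := fun B => F (set_val @^-1` B).
have GF : ProperFilter G.
  split; first exact: (@filter_not_empty _ F FF).
  split; first exact: (@filterT _ F).
    by move=> B C; exact: (@filterI _ F).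
  by move=> B C BC FB; exact: (filterS (fun t => BC (set_val t)) FB).
have [|a [Aa cla]] := cA G GF.
  rewrite /G (_ : _ @^-1` _ = setT); first exact: filterT.
  by apply/seteqP; split=> // t _; exact: set_valP.
exists (exist _ a (mem_set Aa)); split=> // B D FB [_ [[C oC <-]] Ca CD].
have [_ [[t Bt <-] Ct]] : ((set_val : A -> T) @` B) `&` C !=set0.
  apply: cla; last by apply: open_nbhs_nbhs.
  have BV : B `<=` set_val @^-1` ((set_val : A -> T) @` B).
    by move=> t Bt; exists t.
  exact: (filterS BV FB).
by exists t; split=> //; exact: CD.
Qed.

Lemma set_type_hausdorff : hausdorff_space T -> hausdorff_space A.
Proof.
move=> hT s t clst; apply/val_inj/hT => B C Bs Ct.
have cv : continuous (set_val : A -> T) by exact: initial_continuous.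
have [w [Bw Cw]] := clst _ _ (cv s B Bs) (cv t C Ct).
by exists (set_val w).
Qed.

End SubtypeTopology.

Section EssentialSupremum.
Variables (R : realType) (K : topologicalType).

(** Two representatives of a class agree off a meager set, hence at some point
    of [A]. *)
Lemma m0_norm_ge (f : linf R K) (A : set K) (a : R) : ~ first_category A ->
  (forall t, A t -> a <= `|f t|) -> a <= `|m0_proj f|.
Proof.
move=> nA Af; apply: lb_le_inf => [|_ [g gf <-]].
  by exists `|f|, f.
have gfm : g - f \in @m_pred R K by apply/m0_projP.
have [t [At gt]] : exists t, A t /\ g t = f t.
  apply: contrapT => /forallNP h; apply: nA.
  apply: first_category_subset (set_mem gfm) => t At /=.
  apply/eqP => /eqP; rewrite -[X in X == _]/(g t - f t) subr_eq0 => /eqP gt.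
  by apply: (h t).
by apply: le_trans (Af t At) _; rewrite -gt; exact: sup_norm_ge.
Qed.

Lemma m0_norm_le (f : linf R K) : `|m0_proj f| <= `|f|.
Proof. exact: quotient_norm_le. Qed.

(** If [`|f t|] exceeded [c] only on a meager set, setting [f] to zero there
    would give a representative of the same class with norm at most [c]. *)
Lemma m0_norm_lt_nonmeager (f : linf R K) (c : R) : 0 <= c ->
  c < `|m0_proj f| -> ~ first_category [set t | c < `|f t|].
Proof.
move=> c0 cf fc.
have gP : (fun t => if `|f t| <= c then f t else 0 : R^o) \in @linf_pred R K.
  by apply/linf_predP; exists c => t; case: ifP; rewrite ?normr0.
pose g : linf R K := Linf gP.
have gf : m0_proj g = m0_proj f.
  apply/m0_projP/mem_set; apply: first_category_subset fc => t /=.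
  rewrite -[X in X != _]/((if `|f t| <= c then f t else 0) - f t).
  by case: lerP => //; rewrite subrr eqxx.
move: cf; rewrite -gf ltNge; case/negP; apply: le_trans (m0_norm_le g) _.
apply: sup_norm_le => // t.
rewrite -[X in `|X|]/(if `|f t| <= c then f t else 0).
by case: ifP; rewrite ?normr0.
Qed.

End EssentialSupremum.

(** * Consequences of the Daugavet property *)

Section Daugavet.
Variables (R : realType) (X : normedModType R).
Hypotheses (X_separable : separable X) (X_neq0 : exists x : X, x != 0).

Local Notation K := (ex_closure X).
Local Notation absR := (fun r : R^o => `|r|).

Lemma ex_closure_compact : compact [set: K].
Proof.
apply: set_type_compact; apply: subclosed_compact (@dual_ball_compact R X) _.
  exact: closed_closure.
exact: ex_closure_sub.
Qed.

Lemma ex_closure_hausdorff : hausdorff_space K.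
Proof. exact/set_type_hausdorff/dual_hausdorff. Qed.

Lemma ex_closure_baire (U : set K) : open U -> U !=set0 -> ~ first_category U.
Proof. exact: baire_compact ex_closure_compact ex_closure_hausdorff. Qed.

Lemma extreme_in_ex_closure (u : dual_space X) : extreme_points (dual_ball X) u ->
  exists t : K, set_val t = u.
Proof.
move=> ue; have Ku : K u by exact: subset_closure.
by exists (exist _ u (mem_set Ku)).
Qed.

Lemma eval_preimage_open (x : X) (A : set R^o) :
  open A -> open [set t : K | A (set_val t x)].
Proof.
by move=> oA; apply: open_comp oA => t _; exact: (eval_embed_continuous (x := x)).
Qed.

Lemma opnorm1P (g : dual_space X) : opnorm absR g = 1 <->
  dual_ball X g /\ forall e, 0 < e -> exists2 x, `|x| <= 1 & 1 - e < g x.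
Proof.
split=> [g1|[gB gsup]].
  split; first by rewrite /dual_ball /= g1.
  move=> e e0; have [|_ [x /= x1 <-]] := @sup_adherent R
    [set `|g x| | x in [set x : X | `|x| <= 1]] e e0.
    split; first by exists `|g 0|, 0 => //=; rewrite normr0.
    exists 1 => _ [x /= x1 <-]; apply: le_trans x1; apply: dual_ball_le.
    by rewrite /dual_ball /= g1.
  rewrite -/(opnorm absR g) g1 => gx; case: (lerP 0 (g x)) => g0.
    by exists x => //; move: gx; rewrite ger0_norm.
  exists (- x); rewrite ?normrN// linearN.
  by move: gx; rewrite ltr0_norm.
apply/eqP; rewrite eq_le; apply/andP; split; first exact: gB.
apply/ler_addgt0Pr => e e0; have [x x1 gx] := gsup e e0.
rewrite -lerBlDr; apply: le_trans (ltW gx) _; apply: le_trans (ler_norm _) _.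
apply: ub_le_sup; last by exists x.
by exists 1 => _ [y /= y1 <-]; apply: le_trans (dual_ball_le gB y) y1.
Qed.

Hypothesis X_daugavet : daugavet_property X.

(** The Daugavet property, applied to the rank-one operator [g (.) *: x1] where
    [x1] determines a slice of [K] contained in [U], yields a point [x] at
    which [g] is almost maximal while [`|x + g x *: x1|] is almost [2]. An
    extreme functional that norms the latter vector is then almost [1] both
    at [x1], hence lies in [U], and at [x]. *)
Lemma daugavet_slice (U : set K) (g : dual_space X) (e : R) : open U ->
    U !=set0 -> opnorm absR g = 1 -> 0 < e ->
  exists x t, [/\ `|x| <= 1, 1 - e < g x, U t & 1 - e < set_val t x].
Proof.
move=> [U' oU' <-] [t0 Ut0] g1 e0.
have [gB gsup] := (opnorm1P g).1 g1.
have [|x1 [a [nx1 a0 slice]]] := slice_in_open _ _ U' X_neq0 oU'.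
  by exists (set_val t0); split=> //; exact: set_valP.
have x10 : x1 != 0 by rewrite -normr_eq0 nx1 oner_eq0.
have Tlin : linear (fun x => g x *: x1).
  by move=> b x y; rewrite linearP scalerDl scalerA.
pose T : {linear X -> X} := HB.pack (fun x => g x *: x1)
  (GRing.isLinear.Build R X X *:%R (fun x => g x *: x1) Tlin).
have nT x : `|T x| = `|g x| by rewrite normrZ nx1 mulr1.
have T1 : opnorm (fun x : X => `|x|) T = 1.
  rewrite -g1; congr (sup _); apply/seteqP.
  by split=> _ [x xB <-]; exists x => //; exact: nT.
have T2 := X_daugavet T; rewrite T1 in T2.
(* [d <= 1] excludes that [g x * u x1] is a product with [u x1 < 0]. *)
pose d := Num.min 1 (Num.min e a).
have d0 : 0 < d by rewrite !lt_min ltr01 e0.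
have [x x1B] : exists2 x, `|x| <= 1 & 2 - d < `|x + g x *: x1|.
  have [|_ [x /= xB <-]] := @sup_adherent R
      [set `|x + T x| | x in [set x : X | `|x| <= 1]] d d0.
    split; first by exists `|0 + T 0|, 0 => //=; rewrite normr0.
    exists 2 => _ [x /= xB <-]; apply: le_trans (ler_normD _ _) _; rewrite nT.
    by have := dual_ball_le gB x; move: xB; lra.
  move=> h; exists x => //; move: h; rewrite -/(opnorm _ _) T2 //.
  - by exists 1 => y; rewrite nT mul1r; exact: dual_ball_le.
  - exists x1 => //; apply/seteqP; split=> _ [y _ <-]; first by exists (g y).
    have [z _] := gsup 1 ltr01; rewrite subrr => gz.
    exists ((y / g z) *: z) => //; rewrite -[LHS]/(g _ *: x1) linearZ/=.
    by congr (_ *: _); rewrite -[LHS]/(y / g z * g z) divfK// gt_eqF.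
wlog gx0 : x x1B / 0 <= g x.
  move=> wl h; case: (lerP 0 (g x)) => g0; first exact: (wl x).
  apply: (wl (- x)); rewrite ?normrN//; first by rewrite linearN oppr_ge0 ltW.
  by rewrite linearN scaleNr -opprD normrN.
have [u ue <-] := extreme_norming _ _ (x + g x *: x1) X_separable.
have [t tu] := extreme_in_ex_closure _ ue.
have uB : dual_ball X u by case: ue.
have ux := le_trans (ler_norm _) (dual_ball_le uB x).
have ux1 := le_trans (ler_norm _) (dual_ball_le uB x1).
have gx1 := le_trans (ler_norm _) (dual_ball_le gB x).
have -> : u (x + g x *: x1) = u x + g x * u x1 by rewrite linearD linearZ.
have [d1 de da] : [/\ d <= 1, d <= e & d <= a].
  by split; rewrite !ge_min lexx ?orbT.
rewrite nx1 in ux1 => h.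
have u0 : 0 <= u x1 by nra.
have p1 : g x * u x1 <= u x1 by rewrite ler_piMl// (le_trans gx1).
have p2 : g x * u x1 <= g x by rewrite ler_piMr.
exists x, t; rewrite /= tu; split=> //; first by lra.
- by apply: slice; [exact: subset_closure|lra].
- by lra.
Qed.

(** By separability the point of [daugavet_slice] may be replaced by a nearby
    member of a dense sequence, so that only countably many open sets [V n]
    have to be considered. After removal of its meager traces on the [V n], the
    set [A] is still not meager, hence dense in some open set [U]; whenever
    [V n] meets [U], its trace on [A] is therefore not meager. *)
Lemma daugavet_slice_nonmeager (A : set K) (g : dual_space X) (e : R) :
    ~ first_category A -> opnorm absR g = 1 -> 0 < e ->
  exists x, [/\ `|x| <= 1, 1 - e < g x &
    ~ first_category (A `&` [set t : K | 1 - e < set_val t x])].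
Proof.
move=> nA g1 e0; have [s sP] := dense_sequence _ _ X_separable.
pose V n := [set t : K | 1 - e / 2 < set_val t (s n)].
have oV n : open (V n).
  have o : open [set r : R^o | 1 - e / 2 < r] by exact: open_gt.
  exact: (eval_preimage_open (s n) _ o).
pose M n := [set t | first_category (A `&` V n) /\ (A `&` V n) t].
have M1 n : first_category (M n).
  have [m|m] := pselect (first_category (A `&` V n)).
    by apply: first_category_subset m => t [].
  by apply: first_category_subset (first_category0 _) => t [].
have [U [oU U0 UA]] : exists U, [/\ open U, U !=set0 &
    forall W, open W -> W `<=` U -> W !=set0 ->
      ((A `\` \bigcup_n M n) `&` W) !=set0].
  apply: nonmeager_dense_open => m; apply: nA.
  apply: first_category_subset (first_categoryU m (first_category_bigcup M1)).
  by move=> t At; have [|] := pselect ((\bigcup_n M n) t); [right|left].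
have e2 : 0 < e / 2 by rewrite divr_gt0.
have [x [t [x1 gx Ut tx]]] := daugavet_slice _ _ _ oU U0 g1 e2.
exists x; split=> //; first by move: gx; lra.
have near0 : 0 < Num.min (e / 2) (set_val t x - (1 - e / 2)).
  by rewrite lt_min divr_gt0//= subr_gt0.
have [n] := sP x _ near0; rewrite lt_min => /andP[xn1 xn2].
have diff (t' : K) : `|set_val t' x - set_val t' (s n)| <= `|x - s n|.
  by rewrite -linearB; exact/ex_closure_le/set_valP.
have Vt : V n t.
  have := le_trans (ler_norm _) (diff t); rewrite /V /=.
  by move: xn2; lra.
have [t' [[At' nMt'] [Vt' _]]] : ((A `\` \bigcup_n M n) `&` (V n `&` U)) !=set0.
  apply: UA; [exact: openI|exact: subIsetr|by exists t].
move=> fc; apply: nMt'; exists n => //; split=> //.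
apply: first_category_subset fc => r [Ar Vr]; split=> //.
have := diff r; rewrite ler_norml => /andP[+ _]; move: Vr xn1.
by rewrite /V /=; lra.
Qed.

(** If [t] is isolated, then [daugavet_slice] applies to the open set [[set t]].
    It shows first that [t] has norm one, and then, for [g] equal to [- t],
    that both [t] and [- t] are positive at a common point. *)
Lemma ex_closure_perfect (t : K) : ~ open [set t].
Proof.
move=> ot; have t0 : [set t] !=set0 by exists t.
have tB : dual_ball X (set_val t) by exact/ex_closure_sub/set_valP.
have [x xn0] := X_neq0.
have [v ve vx] := extreme_norming _ _ x X_separable.
have vB : dual_ball X v by case: ve.
have v1 : opnorm absR v = 1.
  apply/opnorm1P; split=> // e e0; exists (`|x|^-1 *: x).
    by rewrite normrZ gtr0_norm ?invr_gt0 ?normr_gt0// mulVf// normr_eq0.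
  have -> : v (`|x|^-1 *: x) = `|x|^-1 * v x by rewrite linearZ.
  by rewrite vx mulVf ?normr_eq0//; lra.
have t1 : opnorm absR (- set_val t) = 1.
  apply/opnorm1P; split.
    by apply/dual_ballP => y; rewrite dual_spaceN normrN; exact: dual_ball_le.
  move=> e e0; have [y [_ [yB _ -> yt]]] := daugavet_slice _ _ _ ot t0 v1 e0.
  by exists (- y); rewrite ?normrN// dual_spaceN linearN opprK.
have [y [_ [_ + -> ]]] := daugavet_slice _ _ _ ot t0 t1 (ltr01 : 0 < 1 :> R).
by rewrite subrr dual_spaceN; lra.
Qed.

Lemma ex_closure_norming (x : X) (e : R) : 0 < e ->
  exists t : K, `|x| - e < set_val t x.
Proof.
move=> e0; have [u ue ux] := extreme_norming _ _ x X_separable.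
by have [t tu] := extreme_in_ex_closure _ ue; exists t; rewrite tu ux; lra.
Qed.

Lemma eval_embed_isometry (x : X) : `|m0_proj (eval_embed x)| = `|x|.
Proof.
apply/eqP; rewrite eq_le; apply/andP; split.
  apply: le_trans (m0_norm_le _ _ _) _; apply: sup_norm_le => // t.
  exact/ex_closure_le/set_valP.
apply/ler_addgt0Pr => e e0; rewrite -lerBlDr.
apply: (@m0_norm_ge _ _ _ [set t : K | `|x| - e < set_val t x]) => [|t /= /ltW].
  apply: ex_closure_baire; last exact: ex_closure_norming.
  have o : open [set r : R^o | `|x| - e < r] by exact: open_gt.
  exact: (eval_preimage_open x _ o).
by move=> h; apply: le_trans h (ler_norm _).
Qed.

End Daugavet.

(** * Linear extensions, embeddings and rank-one operators *)

Section Extensions.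
Variables (R : realType) (Y : normedModType R) (X : submodClosed Y).

Lemma le_norm_linear (f : {linear Y -> R^o}) :
  (forall y, f y <= `|y|) -> forall y, `|f y| <= `|y|.
Proof.
by move=> h y; rewrite ler_norml h andbT lerNl -linearN -[leRHS]normrN.
Qed.

Lemma subsp_val_linear (a : R) (x x' : subsp X) :
  subsp_val (a *: x + x') = a *: subsp_val x + subsp_val x'.
Proof. by []. Qed.

Lemma hahn_banach_extension (u : dual_space (subsp X)) : dual_ball _ u ->
  exists g : {linear Y -> R^o}, (forall y, `|g y| <= `|y|) /\
    forall x : subsp X, g (subsp_val x) = u x.
Proof.
move=> uB; have [|||||g [gle gG]] := @hahn_banach R Y (fun y => `|y|) _ _
    [set (subsp_val x, u x) | x in [set: subsp X]].
- exact: ler_normD.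
- by move=> a y a0; rewrite normrZ gtr0_norm.
- by exists (subsp_val (0 : subsp X), u 0), 0.
- move=> a _ _ [x _ <-] [y _ <-] /=; exists (a *: x + y) => //.
  by congr pair; exact: linearP.
- by move=> _ [x _ <-] /=; exact: le_trans (ler_norm _) (dual_ball_le uB x).
exists g; split; first exact: le_norm_linear.
by move=> x; apply: (gG (subsp_val x, u x)); exists x.
Qed.

(** The functional that is [0] on [X] and [d] at [y] is dominated by the norm,
    because [a * d <= `|x + a *: y|] for [a > 0] is the hypothesis at
    [- a^-1 *: x]. *)
Lemma annihilator_norming (y : Y) (d : R) : 0 <= d ->
    (forall x : subsp X, d <= `|y - subsp_val x|) ->
  exists z : {linear Y -> R^o}, [/\ forall w, `|z w| <= `|w|,
    forall x : subsp X, z (subsp_val x) = 0 & z y = d].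
Proof.
move=> d0 dy; have [|||||z [zle zG]] := @hahn_banach R Y (fun y => `|y|) _ _
    [set (subsp_val x + a *: y, a * d) | x in [set: subsp X] & a in [set: R]].
- exact: ler_normD.
- by move=> a w a0; rewrite normrZ gtr0_norm.
- by exists (subsp_val (0 : subsp X) + 0 *: y, 0 * d); exists 0 => //; exists 0.
- move=> a _ _ [x _ [b _ <-]] [x' _ [c _ <-]] /=.
  exists (a *: x + x') => //; exists (a * b + c) => //.
  by rewrite subsp_val_linear scalerDr scalerDl mulrDl scalerA mulrA addrACA.
- move=> _ [x _ [a _ <-]] /=; have [a0|a0] := lerP a 0.
    by apply: le_trans (normr_ge0 _); rewrite mulr_le0_ge0.
  have -> : subsp_val x + a *: y = a *: (y - subsp_val (- a^-1 *: x)).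
    rewrite -[subsp_val (_ *: _)]/(- a^-1 *: subsp_val x) scalerBr scalerA.
    by rewrite mulrN divff ?gt_eqF// scaleN1r opprK addrC.
  by rewrite normrZ gtr0_norm// ler_pM2l.
exists z; split; first exact: le_norm_linear.
- move=> x; apply: (zG (subsp_val x, 0)); exists x => //; exists 0 => //.
  by rewrite scale0r addr0 mul0r.
- apply: (zG (y, d)); exists 0 => //; exists 1 => //.
  by rewrite scale1r mul1r -[subsp_val 0]/(0 : Y) add0r.
Qed.

End Extensions.

(** A lower bound makes preimages of Cauchy filters Cauchy, and completeness of
    the domain then makes the range closed. *)
Lemma bounded_below_embedding (R : realType) (Y : completeNormedModType R)
    (V : normedModType R) (S : {linear Y -> V}) (c C : R) : 0 < c ->
    (forall y, c * `|y| <= `|S y| <= C * `|y|) -> isomorphic_embedding S.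
Proof.
move=> c0 SY.
have Sge y : c * `|y| <= `|S y| by case/andP: (SY y).
have Sle y : `|S y| <= C * `|y| by case/andP: (SY y).
have Sinv y y' : `|y - y'| <= c^-1 * `|S y - S y'|.
  by rewrite mulrC ler_pdivlMr// mulrC -linearB.
have Sinj : injective S.
  move=> y y' SyE; apply/eqP; rewrite -subr_eq0 -normr_le0.
  by apply: le_trans (Sinv y y') _; rewrite SyE subrr normr0 mulr0.
have Sc : continuous S.
  apply: bounded_linear_continuous; apply/linear_boundedP.
  exists C; split; first exact: num_real.
  by move=> r /ltW Cr y; apply: le_trans (Sle y) _; rewrite ler_wpM2r.
split=> //.
- move=> q clq; pose F : set_system Y := filter_from (nbhs q) (fun B => S @^-1` B).
  have FF : ProperFilter F.
    apply: filter_from_proper => [|B /clq[_ [[y _ <-] By]]]; last by exists y.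
    apply: filter_from_filter; first by exists setT; exact: filterT.
    by move=> A B Aq Bq; exists (A `&` B) => //; exact: filterI.
  have ballF e : 0 < e -> F (S @^-1` ball q e).
    by move=> e0; exists (ball q e) => //; exact: nbhsx_ballx.
  have Fcauchy : cauchy F.
    apply: cauchy_exP => e e0.
    have d0 : 0 < c * e / 2 by rewrite divr_gt0 ?mulr_gt0.
    have [y yq] := filter_ex (ballF _ d0).
    exists y; apply: filterS (ballF _ d0) => y' y'q.
    move: yq y'q; rewrite -!ball_normE /= => yq y'q.
    apply: le_lt_trans (Sinv y y') _; rewrite mulrC ltr_pdivrMr// mulrC.
    rewrite (_ : S y - S y' = (q - S y') - (q - S y)); last first.
      by rewrite opprB addrCA [X in _ = _ + X]addrAC subrr add0r.
    by apply: le_lt_trans (ler_normB _ _) _; move: yq y'q; lra.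
  have /cvg_ex[y Fy] : cvg F by exact: cauchy_cvg.
  exists y => //; apply/eqP; rewrite eq_sym -subr_eq0 -normr_le0.
  apply/ler_addgt0Pr => e e0; rewrite add0r.
  have e2 : 0 < e / 2 by rewrite divr_gt0.
  have FS : F (S @^-1` ball (S y) (e / 2)).
    by apply: Fy; apply: Sc; exact: nbhsx_ballx.
  have [y' [/= yy' qy']] := filter_ex (filterI FS (ballF _ e2)).
  move: yy' qy'; rewrite -!ball_normE /= => yy' qy'.
  rewrite (_ : q - S y = (q - S y') - (S y - S y')); last first.
    by rewrite opprB addrA addrNK.
  by apply: le_trans (ler_normB _ _) _; move: yy' qy'; lra.
- pose g (v : V) := xget 0 [set y | S y = v].
  have gS : cancel S g.
    by move=> y; apply: Sinj; rewrite /g; case: xgetP => [//|/(_ y)/(_ erefl)].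
  exists g => //; apply/subspace_continuousP => _ [y _ <-].
  apply/cvgrPdist_lt => e e0; have d0 : 0 < c * e by rewrite mulr_gt0.
  apply/nbhs_ballP; exists (c * e) => //= v vq [y' _ vE].
  rewrite -[X in `|X - _|]/(g (S y)) -[X in `|_ - X|]/(g v) -vE !gS.
  move: vq; rewrite -vE -ball_normE /= => yy'.
  apply: le_lt_trans (Sinv y y') _.
  by rewrite mulrC ltr_pdivrMr// mulrC.
Qed.

(** The scaling that makes [g] of norm one puts the whole norm of [T] into the
    vector, so that lemmas on slices of the ball apply to [g]. *)
Lemma rank_one_normalized (R : realType) (X : normedModType R) (V : lmodType R)
    (N : V -> R) (T : {linear X -> V}) : is_norm N -> bounded_op N T ->
    rank_one T ->
  exists (g : dual_space X) (v : V),
    [/\ opnorm (fun r : R^o => `|r|) g = 1, forall x, T x = g x *: v,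
        0 < N v & N v = opnorm N T].
Proof.
move=> [ND NZ N0] [M TM] [v vn0 Tv].
have N00 : N 0 = 0 by rewrite -(scale0r (0 : V)) NZ normr0 mul0r.
have N_ge0 w : 0 <= N w.
  have := ND w (- w); rewrite subrr N00 -scaleN1r NZ normrN1 mul1r.
  by lra.
have Nv : 0 < N v.
  by rewrite lt_neqAle N_ge0 andbT eq_sym; apply: contra_neq vn0; exact: N0.
have /choice[f fP] x : exists a, T x = a *: v.
  have : range T (T x) by exists x.
  by rewrite Tv => -[a _ <-]; exists a.
have vinj a b : a *: v = b *: v -> a = b.
  move=> /eqP; rewrite -subr_eq0 -scalerBl scaler_eq0 (negPf vn0) orbF subr_eq0.
  by move/eqP.
have flin a x y : f (a *: x + y) = a * f x + f y.
  by apply: vinj; rewrite -fP linearP !fP scalerDl scalerA.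
have NT x : N (T x) = `|f x| * N v by rewrite fP NZ.
set n := opnorm N T.
have [x0 fx0] : exists x, f x = 1.
  have : range T v by rewrite Tv; exists 1 => //; rewrite scale1r.
  by case=> x _ Tx; exists x; apply: vinj; rewrite -fP scale1r.
have Tle x : N (T x) <= n * `|x|.
  have [->|xn0] := eqVneq x 0; first by rewrite linear0 N00 normr0 mulr0.
  have xp : 0 < `|x| by rewrite normr_gt0.
  rewrite -ler_pdivrMr// mulrC; apply: ub_le_sup.
    exists `|M| => _ [y /= y1 <-]; apply: le_trans (TM y) _.
    apply: le_trans (_ : `|M| * `|y| <= _); last by rewrite ler_piMr.
    by rewrite ler_wpM2r// ler_norm.
  exists (`|x|^-1 *: x); rewrite /=.
    by rewrite normrZ gtr0_norm ?invr_gt0// mulVf// gt_eqF.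
  by rewrite linearZ NZ gtr0_norm// invr_gt0.
have n0 : 0 < n.
  rewrite ltNge; apply/negP => n0; have := Tle x0.
  rewrite NT fx0 normr1 mul1r => h.
  have := le_trans h (mulr_le0_ge0 n0 (normr_ge0 x0)).
  by rewrite leNgt Nv.
have fle x : `|N v / n * f x| <= 1 * `|x|.
  rewrite normrM gtr0_norm ?divr_gt0// mul1r mulrAC ler_pdivrMr//.
  by rewrite mulrC -NT mulrC.
have [|g gf] := bounded_linear_dual _ _ (fun x => N v / n * f x) 1 _ fle.
  by move=> a x y; rewrite flin /GRing.scale/= mulrDr mulrCA.
have vE : N ((n / N v) *: v) = n.
  by rewrite NZ gtr0_norm ?divr_gt0// divfK// gt_eqF.
exists g, ((n / N v) *: v); split; rewrite ?vE//.
- apply/opnorm1P; split.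
    by apply/dual_ballP => x; rewrite gf -[leRHS]mul1r; exact: fle.
  move=> e e0; have [|_ [x /= x1 <-]] := @sup_adherent R
    [set N (T x) | x in [set x : X | `|x| <= 1]] (n * e) (mulr_gt0 n0 e0).
    split; first by exists (N (T 0)), 0 => //=; rewrite normr0.
    exists n => _ [x /= x1 <-]; apply: le_trans (Tle x) _.
    by rewrite ler_piMr// ltW.
  rewrite -/(opnorm N T) -/n NT => nx.
  have {}nx : 1 - e < N v / n * `|f x|.
    rewrite mulrAC ltr_pdivlMr//; move: nx; rewrite mulrC [N v * _]mulrC.
    by lra.
  case: (lerP 0 (f x)) => fx; first by exists x; rewrite // gf -(ger0_norm fx).
  exists (- x); first by rewrite normrN.
  have -> : g (- x) = - g x by exact: linearN.
  by rewrite gf -mulrN -(ltr0_norm fx).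
- move=> x; rewrite fP gf scalerA; congr (_ *: _).
  by field; rewrite !gt_eqF.
Qed.

(** * The embedding and the renorming *)

Section Embedding.
Variables (R : realType) (Y : completeNormedModType R) (X : submodClosed Y).
Hypotheses (X_neq0 : exists x : subsp X, x != 0) (Y_separable : separable Y)
  (X_separable : separable (subsp X)) (X_daugavet : daugavet_property (subsp X)).

Local Notation K := (ex_closure (subsp X)).

(** A point [t] belongs to at most one of the disjoint sets [W j], and [g t] is
    its Hahn-Banach extension, increased by [32 * z j] in that case. As [z j]
    norms the class of the [j]-th point of a dense sequence modulo [X], every
    distance to [X] is almost attained by some [z j]. The [W j] lie in the
    slice of [x1], so that on the opposite side the extension has norm at most
    one. *)
Lemma perturbed_extensions : exists (x1 : subsp X) (W : nat -> set K)
    (z : nat -> {linear Y -> R^o}) (g : K -> {linear Y -> R^o}),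
  [/\ forall j, open (W j) /\ W j !=set0,
      forall j t, W j t -> 1 / 2 < set_val t x1,
      forall j y, `|z j y| <= `|y|,
      forall y e d, 0 < e -> 0 <= d ->
        (forall x : subsp X, d + e <= `|y - subsp_val x|) ->
        exists j, d - e <= z j y &
  [/\ forall t y, `|g t y| <= 33 * `|y|,
      forall t (x : subsp X), g t (subsp_val x) = set_val t x,
      forall j t y, W j t -> 32 * z j y - `|y| <= g t y &
      forall t y, (forall j, ~ W j t) -> `|g t y| <= `|y|]].
Proof.
have [x0 x00] := X_neq0.
pose x1 := `|x0|^-1 *: x0.
have x11 : `|x1| = 1.
  by rewrite normrZ gtr0_norm ?invr_gt0 ?normr_gt0// mulVf// normr_eq0.
have o1 : open [set r : R^o | 1 / 2 < r] by exact: open_gt.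
have [|W [oW W0 WH tW]] := disjoint_open_sequence _ _ (ex_closure_hausdorff _ _)
  (ex_closure_perfect _ _ X_separable X_neq0 X_daugavet)
  (eval_preimage_open _ _ x1 _ o1).
  have [t] := ex_closure_norming _ _ X_separable x1 (1 / 2)
    (divr_gt0 ltr01 (ltr0Sn _ 1)).
  by rewrite x11 => h; exists t => /=; lra.
have [s sP] := dense_sequence _ _ Y_separable.
have /choice[z zP] j : exists z : {linear Y -> R^o},
    [/\ forall w, `|z w| <= `|w|, forall x : subsp X, z (subsp_val x) = 0 &
    forall d, (forall x : subsp X, d <= `|s j - subsp_val x|) -> d <= z (s j)].
  pose D := [set `|s j - subsp_val x| | x in [set: subsp X]].
  have D0 : D !=set0 by exists `|s j - subsp_val (0 : subsp X)|, 0.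
  have Dinf (x : subsp X) : inf D <= `|s j - subsp_val x|.
    by apply: ge_inf; [exists 0 => _ [x' _ <-]|exists x].
  have Dge d : (forall x : subsp X, d <= `|s j - subsp_val x|) -> d <= inf D.
    by move=> dD; apply: lb_le_inf => // _ [x _ <-].
  have [z [z1 z2 z3]] := annihilator_norming _ _ _ _ _
    (Dge 0 (fun=> normr_ge0 _)) Dinf.
  by exists z; split=> // d /Dge; rewrite z3.
have /choice[g gP] (t : K) : exists g : {linear Y -> R^o},
    [/\ forall y, `|g y| <= 33 * `|y|,
      forall x : subsp X, g (subsp_val x) = set_val t x,
      forall j y, W j t -> 32 * z j y - `|y| <= g y &
      forall y, (forall j, ~ W j t) -> `|g y| <= `|y|].
  have tB : dual_ball (subsp X) (set_val t) by exact/ex_closure_sub/set_valP.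
  have [h [hle hX]] := hahn_banach_extension _ _ _ _ tB.
  have [[j Wjt]|nW] := pselect (exists j, W j t); last first.
    exists h; split=> //.
    - by move=> y; apply: le_trans (hle y) _; have := normr_ge0 y; lra.
    - by move=> j y Wjt; case: nW; exists j.
  have [zle zX _] := zP j.
  have glin : linear (fun y => h y + 32 * z j y : R^o).
    move=> a y y'; rewrite !linearP /GRing.scale/=; ring.
  pose gl : {linear Y -> R^o} := HB.pack (fun y => h y + 32 * z j y : R^o)
    (GRing.isLinear.Build R Y R^o *:%R _ glin).
  exists gl; split=> /=.
  - move=> y; apply: le_trans (ler_normD _ _) _; rewrite normrM ger0_norm//.
    by have := hle y; have := zle y; lra.
  - by move=> x; rewrite hX zX mulr0 addr0.
  - move=> i y Wit; have -> : i = j by apply: tW => //; exists t.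
    by have := hle y; rewrite ler_norml => /andP[+ _]; lra.
  - by move=> y /(_ j).
exists x1, W, z, g; split=> //.
- by move=> j; have [] := zP j.
- move=> y e d e0 d0 yX; have [j yj] := sP y e e0; exists j.
  have [zle _ zs] := zP j.
  have := le_trans (ler_norm _) (zle (s j - y)); rewrite linearB distrC.
  have : d <= z j (s j).
    apply: zs => x; have := ler_distD (s j) y (subsp_val x); have := yX x.
    by move: yj; lra.
  by move: yj; lra.
- split=> [t|t|j t y|t]; have [g_le gX gW gnW] := gP t => //.
  exact: gW.
Qed.

(** If some [x] of [X] is within [`|y| / 8] of [y], the extensions of norm at
    most one outside the slice of [x1] are used: there [`|g t y|] exceeds
    [`|x| / 2 - `|y| / 8], which is at least [5 / 16 * `|y|]. Otherwise some
    [z j y] is at least [3 / 32 * `|y|], and [32 * z j] dominates the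
    unperturbed part, which is at most [`|y|]. *)
Lemma extension_bounded_below : exists S : {linear Y -> m0 R K},
  (forall y, 1 / 4 * `|y| <= `|S y| <= 33 * `|y|) /\
  forall x : subsp X, S (subsp_val x) = m0_proj (eval_embed x).
Proof.
have [x1 [W [z [g [oW Wx1 zle zdist [gle gX gW gnW]]]]]] := perturbed_extensions.
have SP y : (fun t => g t y) \in @linf_pred R K.
  by apply/linf_predP; exists (33 * `|y|) => t.
have Slin : linear (fun y => m0_proj (Linf (SP y))).
  move=> a y y'; rewrite -linearP; congr m0_proj; apply/val_inj/funext => t.
  exact: linearP.
pose S : {linear Y -> m0 R K} := HB.pack (fun y => m0_proj (Linf (SP y)))
  (GRing.isLinear.Build R Y (m0 R K) *:%R _ Slin).
exists S; split=> /= [y|x]; last first.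
  by congr m0_proj; apply/val_inj/funext => t; exact: gX.
apply/andP; split; last first.
  apply: le_trans (m0_norm_le _ _ _) _; apply: sup_norm_le => [|t]; last exact: gle.
  by rewrite mulr_ge0.
have [->|yn0] := eqVneq y 0; first by rewrite normr0 mulr0.
have yp : 0 < `|y| by rewrite normr_gt0.
have [[x xy]|far] := pselect (exists x : subsp X, `|y - subsp_val x| < `|y| / 8).
  have nx : 7 / 8 * `|y| <= `|x|.
    have := lerB_dist y (y - subsp_val x); rewrite subKr.
    by rewrite -[`|x|]/`|subsp_val x|; lra.
  pose V := [set t : K | `|x| / 2 < `|set_val t x|] `&`
    [set t : K | set_val t x1 < 1 / 2].
  have oV : open V.
    have o1 : open [set r : R^o | `|x| / 2 < `|r|].
      apply: (@open_comp R^o R (fun r => `|r|) [set r | `|x| / 2 < r]).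
        by move=> r _; exact: (@norm_continuous R R^o r).
      exact: open_gt.
    have o2 : open [set r : R^o | r < 1 / 2] by exact: open_lt.
    exact: openI (eval_preimage_open _ _ x _ o1) (eval_preimage_open _ _ x1 _ o2).
  have V0 : V !=set0.
    have [u ue ux] := extreme_norming _ _ x X_separable.
    (* The two opposite extreme points cannot both lie in the slice of [x1]. *)
    have [t tu] := extreme_in_ex_closure _ _ _ ue.
    have [t' tu'] := extreme_in_ex_closure _ _ _ (extreme_point_opp _ _ _ ue).
    have [u1|u1] := ltP (u x1) (1 / 2).
      exists t; split; rewrite /= tu // ux normr_id.
      by move: yp nx; lra.
    exists t'; split; rewrite /= tu' dual_spaceN; last by lra.
    by rewrite normrN ux normr_id; move: yp nx; lra.
  apply: (@m0_norm_ge _ _ _ V) => [|t [/= tx tx1]].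
    exact: ex_closure_baire oV V0.
  have nW j : ~ W j t by move=> /Wx1; rewrite ltNge ltW.
  have := gnW t (y - subsp_val x) nW; rewrite linearB gX => h1.
  have := lerB_dist (set_val t x) (set_val t x - g t y).
  rewrite subKr distrC => h2.
  by move: xy nx tx h1 h2; lra.
have [|||j zj] := zdist y (`|y| / 64) (7 / 64 * `|y|).
- by rewrite divr_gt0.
- by rewrite mulr_ge0.
- move=> x; rewrite leNgt; apply/negP => h; apply: far; exists x.
  by move: h; lra.
have [oWj Wj0] := oW j.
apply: (@m0_norm_ge _ _ _ (W j)) => [|t Wjt]; first exact: ex_closure_baire oWj Wj0.
apply: le_trans (ler_norm _); have := gW j t y Wjt.
by move: zj yp; rewrite /=; lra.
Qed.

(** On the non-meager set given by [daugavet_slice_nonmeager], the function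
    that represents [S (J x + T x)], with [J] the inclusion, is a sum of [x],
    which is almost [1], and of [g x *: f], which is almost [n]. *)
Lemma embedding_daugavet_pair (S : {linear Y -> m0 R K}) :
    is_norm (fun y => `|S y|) ->
    (forall x : subsp X, S (subsp_val x) = m0_proj (eval_embed x)) ->
  daugavet_pair (fun y => `|S y|) (@subsp_val R Y X).
Proof.
move=> SN SX T Tb T1.
have [g [v [g1 TE Nv vE]]] := rank_one_normalized _ _ _ _ _ SN Tb T1.
rewrite -vE; set n := `|S v| in Nv vE *.
have gB : dual_ball _ g by have [] := (opnorm1P _ _ g).1 g1.
pose JT (x : subsp X) := subsp_val x + T x.
have JTle x : `|x| <= 1 -> `|S (JT x)| <= 1 + n.
  move=> x1; rewrite linearD SX; apply: le_trans (ler_normD _ _) _.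
  rewrite eval_embed_isometry// TE linearZ normrZ lerD//.
  by apply: ler_piMl => //; exact: le_trans (dual_ball_le gB x) x1.
have JTsup x : `|x| <= 1 -> `|S (JT x)| <= opnorm (fun y => `|S y|) JT.
  move=> x1; apply: ub_le_sup; last by exists x.
  by exists (1 + n) => _ [y /= y1 <-]; exact: JTle.
apply/eqP; rewrite eq_le; apply/andP; split.
  apply: ge_sup => [|_ [x /= x1 <-]]; last exact: JTle.
  by exists `|S (JT 0)|, 0 => //=; rewrite normr0.
apply/ler_addgt0Pr => e e0; rewrite -lerBlDr.
(* [(1 - d) + n * (1 - d) ^+ 2] is at least [1 + n - d * (1 + 2 * n)]. *)
pose d := Num.min 1 (e / (2 + 2 * n)).
have n2 : 0 < 2 + 2 * n by lra.
have d0 : 0 < d by rewrite lt_min ltr01 divr_gt0.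
have d1 : d <= 1 by rewrite ge_min lexx.
have de : d * (2 + 2 * n) <= e by rewrite -ler_pdivlMr// ge_min lexx orbT.
have cd0 : 0 <= 1 - d by rewrite subr_ge0.
have n_ge0 := ltW Nv.
have nd0 : 0 <= n * (1 - d) by rewrite mulr_ge0.
have key (f : linf R K) (h : dual_space (subsp X)) :
    opnorm (fun r : R^o => `|r|) h = 1 ->
    ~ first_category [set t | n * (1 - d) < f t] ->
    (forall x, S (JT x) = m0_proj (eval_embed x + h x *: f)) ->
    1 + n - e <= opnorm (fun y => `|S y|) JT.
  move=> h1 nf SE.
  have [x [x1 hx nA]] := daugavet_slice_nonmeager _ _ X_separable X_neq0
    X_daugavet _ _ _ nf h1 d0.
  apply: le_trans (JTsup x x1); rewrite SE.
  apply: (m0_norm_ge _ _ _ _ _ nA) => t [/= ft tx].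
  apply: le_trans (ler_norm _); rewrite -[leRHS]/(set_val t x + h x * f t).
  have hf : (1 - d) * (n * (1 - d)) <= h x * f t.
    by apply: ler_pM => //; exact: ltW.
  have : 0 <= n * d ^+ 2 by rewrite mulr_ge0// ?sqr_ge0.
  by move: hf de tx; lra.
have [f fv] : exists f : linf R K, m0_proj f = S v.
  by exists (repr (S v)); exact: m0_projK.
have SE x : S (JT x) = m0_proj (eval_embed x + g x *: f).
  by rewrite linearD SX TE linearZ m0_projD m0_projZ fv.
have nf : ~ first_category [set t | n * (1 - d) < `|f t|].
  by apply: m0_norm_lt_nonmeager => //; rewrite fv -/n; nra.
(* [f] may be large only in absolute value; then change the signs of [f] and
   [g]. *)
have [f1|f1] := pselect (first_category [set t | n * (1 - d) < f t]); last first.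
  exact: key f1 SE.
apply: (key (- f) (- g)).
- apply/opnorm1P; have [_ gsup] := (opnorm1P _ _ g).1 g1; split.
    by apply/dual_ballP => x; rewrite dual_spaceN normrN; exact: dual_ball_le.
  move=> e' e'0; have [x x1 gx] := gsup e' e'0.
  exists (- x); first by rewrite normrN.
  by rewrite dual_spaceN linearN opprK.
- move=> f2; apply: nf; apply: first_category_subset (first_categoryU f1 f2).
  move=> t /=.
  by rewrite ltr_normr => /orP[]; [left|right].
- by move=> x; rewrite SE dual_spaceN scalerN scaleNr opprK.
Qed.

End Embedding.

Theorem theorem2p5 (R : realType) (Y : completeNormedModType R)
    (X : submodClosed Y)
    (X_closed : closed [set y : Y | y \in X])
    (X_neq0 : exists2 x : Y, x \in X & x != 0)
    (Y_separable : separable Y)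
    (X_separable : separable (subsp X))
    (X_daugavet : daugavet_property (subsp X)) :
  (exists S : {linear Y -> m0 R (ex_closure (subsp X))},
     isomorphic_embedding S /\
     forall x : subsp X, S (subsp_val x) = m0_proj (eval_embed x))
  /\
  (exists N : Y -> R,
     [/\ equivalent_norm N,
         forall x : subsp X, N (subsp_val x) = `|subsp_val x| &
         daugavet_pair N (@subsp_val R Y X)]).
Proof.
have {}X_neq0 : exists x : subsp X, x != 0.
  have [x xX xn0] := X_neq0; exists (Subsp xX).
  by apply: contra_neq xn0 => /(congr1 (@subsp_val R Y X)).
have [S [Sb SX]] := extension_bounded_below _ _ _ X_neq0 Y_separable
  X_separable X_daugavet.
split.
  exists S; split=> //.
  exact: (bounded_below_embedding _ _ _ _ (1 / 4) 33 (divr_gt0 _ _) Sb).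
have SN : is_norm (fun y => `|S y|).
  split=> [x y|a x|x Sx0]; first by rewrite linearD ler_normD.
    by rewrite linearZ normrZ.
  apply/eqP; rewrite -normr_le0; have /andP[+ _] := Sb x.
  by rewrite Sx0; lra.
exists (fun y => `|S y|); split.
- split=> //; exists (1 / 4), 33; split=> //; lra.
- by move=> x; rewrite SX eval_embed_isometry.
- exact: embedding_daugavet_pair.
Qed.
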